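(* Let $q\ge1$ be an integer and let $\tilde T$ be any repartitioning of $T_{\mathrm{cw}}\otimes T_{\mathrm{cw}}$, where $T_{\mathrm{cw}}=T_{\mathrm{cw}}(q)$, made into an estimated partitioned tensor as described in the context. Then for all $\rho\in[2,3]$, $V^{\mathrm{m}}_\rho(T_{\mathrm{cw}})\ge V^{\mathrm{pr}}_\rho(\tilde T)^{1/2}$.
   Context: Tensors are trilinear forms $\sum T_{xyz}xyz$ over a field on finite variable sets $X,Y,Z$; equivalent tensors differ by bijective renamings of $x$-, $y$-, $z$-variables separately; $\langle n,m,p\rangle=\sum x_{ij}y_{jk}z_{ki}$ and tensors equivalent to it are matrix multiplication tensors, of volume $nmp$. Tensor products are over product variable sets. Rotation: $T^{\mathrm{rot}}=\sum T_{xyz}\,yzx$ over $Y,Z,X$, $T^{\mathrm{rot}2}=(T^{\mathrm{rot}})^{\mathrm{rot}}$. Partitioned tensor: $X=\bigsqcup_{i\in I}X_i$, $Y=\bigsqcup_{j\in J}Y_j$, $Z=\bigsqcup_{k\in K}Z_k$, $T=\sum_sT_s$, each constituent $T_s$ a nonzero tensor over $X_i,Y_j,Z_k$ for an annotation $s=(i,j,k)$, distinct constituents having distinct annotations; $\operatorname{supp}(T)$ = annotations. Products are partitioned by products of parts, with constituents $T_s\otimes T'_{s'}$; $T^{\otimes N}$ has constituents $\bigotimes_iT_{s_i}$; annotations of powers are index triples; a set of index triples is strongly disjoint if no two share an $x$-, $y$- or $z$-index. Symmetric: $I=J=K$ and $T_{(i,j,k)}\approx T_{(j,k,i)}$. Partitioned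 restriction: zero all variables of some parts. Estimated partitioned tensor: functions $\mathrm{Val}_\rho(T_s)\ge0$ ($\rho\in[2,3]$), equal to $\mathrm{Vol}(T_s)^{\rho/3}$ when $T_s$ is a matrix multiplication tensor; values multiply under products and are kept under rotation. $T$ has symmetric value estimates if $\mathrm{Val}_\rho(T_{(i,j,k)})=\mathrm{Val}_\rho(T_{(j,k,i)})$. Partition-restricted value: $V^{\mathrm{pr}}_{\rho,3N}(T)$ = max of $\sum_{s\in\operatorname{supp}(T')}\mathrm{Val}_\rho(T'_s)$ over partitioned restrictions $T'$ of $(T\otimes T^{\mathrm{rot}}\otimes T^{\mathrm{rot}2})^{\otimes N}$ with strongly disjoint support; $V^{\mathrm{pr}}_\rho(T)=\lim_NV^{\mathrm{pr}}_{\rho,3N}(T)^{1/3N}$. Merging value (for symmetric $T$): $\operatorname{supp}_0(T)$ = annotations with $T_s$ a matrix multiplication tensor, $\operatorname{supp}_*(T)$ the rest. Pattern $\pi:[N]\to\operatorname{supp}_*(T)\cup\{0\}$; $T^{\otimes N}_s$ conforms to $\pi$ if $s_i=\pi(i)$ when $\pi(i)\ne0$, $s_i\in\operatorname{supp}_0(T)$ when $\pi(i)=0$; $T^{(0)}_s=\bigotimes_{\pi(i)=0}T_{s_i}$. A sum $S$ of distinct constituents of $T^{\otimes N}$ is consistent if all conform to a common $\pi$ and $\sum T^{(0)}_s$ is equivalent to a matrix multiplication tensor $S^{(0)}$; $\mathrm{Val}_\rho(S)=\mathrm{Vol}(S^{(0)})^{\rho/3}\prod_{\pi(i)\neq0}\mathrm{Val}_\rho(T_{\pi(i)})$.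 A consistent restriction of $T^{\otimes N}$: from a partitioned restriction $R$ of $T^{\otimes N}$, partition its constituents into classes each summing to a consistent sum, sums of distinct classes having pairwise disjoint $x$-, $y$-, $z$-variables. $V^{\mathrm{m}}_{\rho,N}(T)$ = max over consistent restrictions of the total $\mathrm{Val}_\rho$ of class sums; $V^{\mathrm{m}}_\rho(T)=\lim_NV^{\mathrm{m}}_{\rho,N}(T)^{1/N}$. Coppersmith--Winograd tensor: $T_{\mathrm{cw}}(q)=\sum_{i=1}^q(x_0y_iz_i+x_iy_0z_i+x_iy_iz_0)+x_0y_0z_{q+1}+x_0y_{q+1}z_0+x_{q+1}y_0z_0$, partitioned with $X_0=\{x_0\}$, $X_1=\{x_1,\dots,x_q\}$, $X_2=\{x_{q+1}\}$ and likewise for $Y,Z$; its six constituents (annotations $(0,1,1),(1,0,1),(1,1,0),(2,0,0),(0,2,0),(0,0,2)$) are matrix multiplication tensors, with estimated values $\mathrm{Vol}^{\rho/3}$. Repartitioning: let $T,T'$ be symmetric estimated partitioned tensors with symmetric value estimates, with index sets $I,J,K$ and $I',J',K'$. A repartitioning of $T\otimes T'$ is the tensor $T\otimes T'$ regarded as a partitioned tensor with respect to partitions $\tilde X_{\tilde\imath}=\bigcup_{(i,i')\in x(\tilde\imath)}X_i\times X'_{i'}$, $\tilde Y_{\tilde\jmath}=\bigcup_{(j,j')\in y(\tilde\jmath)}Y_j\times Y'_{j'}$, $\tilde Z_{\tilde k}=\bigcup_{(k,k')\in z(\tilde k)}Z_k\times Z'_{k'}$ coarsening the product partitions (i.e.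 $\{x(\tilde\imath)\}$ partitions $I\times I'$, etc.). It is made an estimated partitioned tensor as follows: if a constituent $\tilde T_{\tilde\imath,\tilde\jmath,\tilde k}$ is a matrix multiplication tensor its value is $\mathrm{Vol}^{\rho/3}$; otherwise its value is $V^{\mathrm{pr}}_\rho$ of $\tilde T_{\tilde\imath,\tilde\jmath,\tilde k}$ regarded as an estimated partitioned tensor with $x$-parts $X_i\times X'_{i'}$ ($(i,i')\in x(\tilde\imath)$), etc., support $\{((i,i'),(j,j'),(k,k'))\in x(\tilde\imath)\times y(\tilde\jmath)\times z(\tilde k):(i,j,k)\in\operatorname{supp}(T),(i',j',k')\in\operatorname{supp}(T')\}$, constituents $T_{i,j,k}\otimes T'_{i',j',k'}$ and values $\mathrm{Val}_\rho(T_{i,j,k})\mathrm{Val}_\rho(T'_{i',j',k'})$. *)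

(* Defs.v *)
From HB Require Import structures.
From mathcomp Require Import all_boot all_order all_algebra.
From mathcomp Require Import all_classical all_reals all_analysis.

Set Implicit Arguments.
Unset Strict Implicit.
Unset Printing Implicit Defensive.

Import Order.TTheory GRing.Theory Num.Theory.
Import numFieldNormedType.Exports.

Local Open Scope ring_scope.

(** * Tensors *)

Definition tensor (F : fieldType) (X Y Z : finType) := X -> Y -> Z -> F.

Definition tensor_equiv (F : fieldType) (X Y Z X' Y' Z' : finType)
    (T : tensor F X Y Z) (T' : tensor F X' Y' Z') : Prop :=
  exists (f : X -> X') (g : Y -> Y') (h : Z -> Z'),
    [/\ bijective f, bijective g, bijective h &
        forall x y z, T x y z = T' (f x) (g y) (h z)].

Definition matmul (F : fieldType) (n m p : nat) :
    tensor F ('I_n * 'I_m)%type ('I_m * 'I_p)%type ('I_p * 'I_n)%type :=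
  fun x y z => [&& x.2 == y.1, y.2 == z.1 & z.2 == x.1]%:R.
Arguments matmul : clear implicits.

Definition has_volume (F : fieldType) (X Y Z : finType)
    (T : tensor F X Y Z) (v : nat) : Prop :=
  exists n m p : nat,
    [/\ (0 < n)%N, (0 < m)%N, (0 < p)%N, v = (n * m * p)%N &
        tensor_equiv T (matmul F n m p)].

Definition is_matmul (F : fieldType) (X Y Z : finType)
    (T : tensor F X Y Z) : Prop := exists v, has_volume T v.

(* The volume of a matrix multiplication tensor is unique, since
   v ^ 2 = #|X| * #|Y| * #|Z|; the default 0 is for all other tensors. *)
Definition volume (F : fieldType) (X Y Z : finType)
    (T : tensor F X Y Z) : nat := xget 0%N [set v | has_volume T v]%classic.

Definition tensor_sub (F : fieldType) (X Y Z : finType) (T : tensor F X Y Z)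
    (A : {set X}) (B : {set Y}) (C : {set Z}) :
    tensor F {x | x \in A} {y | y \in B} {z | z \in C} :=
  fun x y z => T (\val x) (\val y) (\val z).
Arguments tensor_sub {F X Y Z} T A B C.

Definition tensor_family (F : fieldType) (D X Y Z : finType)
    (T : D -> tensor F X Y Z) :
    tensor F {ffun D -> X} {ffun D -> Y} {ffun D -> Z} :=
  fun x y z => \prod_(l : D) T l (x l) (y l) (z l).

(** * Partitioned tensors *)

(* The parts are the fibres X_i = xpart^-1(i).  The constituents are determined
   by the tensor and the partitions, as the blocks T|(X_i x Y_j x Z_k) that are
   nonzero. *)
Record ptensor (F : fieldType) := PTensor {
  xvar : finType; yvar : finType; zvar : finType;
  xidx : finType; yidx : finType; zidx : finType;
  xpart : xvar -> xidx; ypart : yvar -> yidx; zpart : zvar -> zidx;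
  coef : tensor F xvar yvar zvar }.

Definition annot (F : fieldType) (T : ptensor F) : finType :=
  (xidx T * yidx T * zidx T)%type.

Definition xblock (F : fieldType) (T : ptensor F) (i : xidx T) :
  {set xvar T} := [set x | xpart x == i].
Definition yblock (F : fieldType) (T : ptensor F) (j : yidx T) :
  {set yvar T} := [set y | ypart y == j].
Definition zblock (F : fieldType) (T : ptensor F) (k : zidx T) :
  {set zvar T} := [set z | zpart z == k].

(* T_s as a tensor over X_i, Y_j, Z_k. *)
Definition constituent (F : fieldType) (T : ptensor F) (s : annot T) :=
  tensor_sub (@coef F T) (xblock s.1.1) (yblock s.1.2) (zblock s.2).
Arguments constituent {F T} s.

(* T_s extended by zero to all variables, so that constituents can be added. *)
Definition constituent0 (F : fieldType) (T : ptensor F) (s : annot T) :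
    tensor F (xvar T) (yvar T) (zvar T) :=
  fun x y z =>
    if [&& x \in xblock s.1.1, y \in yblock s.1.2 & z \in zblock s.2]
    then coef x y z else 0.
Arguments constituent0 {F T} s.

Definition supp (F : fieldType) (T : ptensor F) : {set annot T} :=
  [set s : annot T |
    [exists x in xblock s.1.1, exists y in yblock s.1.2,
      exists z in zblock s.2, coef x y z != 0]].

Definition kept (F : fieldType) (T : ptensor F) : finType :=
  ({set xidx T} * {set yidx T} * {set zidx T})%type.

(* Zeroes the variables of all parts whose index is not kept. *)
Definition prestrict (F : fieldType) (T : ptensor F) (A : kept T) : ptensor F :=
  @PTensor F (xvar T) (yvar T) (zvar T) (xidx T) (yidx T) (zidx T)
    (@xpart F T) (@ypart F T) (@zpart F T)
    (fun x y z =>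
       if [&& xpart x \in A.1.1, ypart y \in A.1.2 & zpart z \in A.2]
       then coef x y z else 0).

Definition strongly_disjoint (I J K : finType) (S : {set I * J * K}) : bool :=
  [forall s in S, forall t in S, (s != t) ==>
    [&& s.1.1 != t.1.1, s.1.2 != t.1.2 & s.2 != t.2]].

(** * Estimated partitioned tensors *)

(* [est rho s] is Val_rho(T_s); only its values for s in supp T matter.  The
   requirements on estimates (nonnegative, Vol^(rho/3) on matrix multiplication
   tensors) are not record fields: multiplicative estimates on a product need
   not satisfy the second one when a product of two constituents that are not
   matrix multiplication tensors happens to be one, e.g. 2xyz and (1/2)xyz.
   They hold for the tensors [cw] and [repartition] below. *)
Record etensor (R : realType) (F : fieldType) := ETensor {
  etens :> ptensor F;
  est : R -> annot etens -> R }.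

Definition etensor_prod (R : realType) (F : fieldType) (T T' : etensor R F) :
    etensor R F :=
  @ETensor R F
    (@PTensor F
      (xvar T * xvar T')%type (yvar T * yvar T')%type (zvar T * zvar T')%type
      (xidx T * xidx T')%type (yidx T * yidx T')%type (zidx T * zidx T')%type
      (fun x => (xpart x.1, xpart x.2))
      (fun y => (ypart y.1, ypart y.2))
      (fun z => (zpart z.1, zpart z.2))
      (fun x y z => coef x.1 y.1 z.1 * coef x.2 y.2 z.2))
    (fun rho s =>
       @est R F T rho (s.1.1.1, s.1.2.1, s.2.1) *
       @est R F T' rho (s.1.1.2, s.1.2.2, s.2.2)).

Definition etensor_rot (R : realType) (F : fieldType) (T : etensor R F) :
    etensor R F :=
  @ETensor R F
    (@PTensor F (yvar T) (zvar T) (xvar T) (yidx T) (zidx T) (xidx T)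
      (@ypart F T) (@zpart F T) (@xpart F T)
      (fun y z x => coef x y z))
    (fun rho s => @est R F T rho (s.2, s.1.1, s.1.2)).

Definition ptensor_pow (F : fieldType) (T : ptensor F) (N : nat) : ptensor F :=
  @PTensor F
    {ffun 'I_N -> xvar T} {ffun 'I_N -> yvar T} {ffun 'I_N -> zvar T}
    {ffun 'I_N -> xidx T} {ffun 'I_N -> yidx T} {ffun 'I_N -> zidx T}
    (fun x => [ffun l => xpart (x l)])
    (fun y => [ffun l => ypart (y l)])
    (fun z => [ffun l => zpart (z l)])
    (tensor_family (fun _ : 'I_N => @coef F T)).

(* The component s_l of an annotation s of a power. *)
Definition annot_at (F : fieldType) (T : ptensor F) (N : nat)
    (s : annot (ptensor_pow T N)) (l : 'I_N) : annot T :=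
  (s.1.1 l, s.1.2 l, s.2 l).

Definition etensor_pow (R : realType) (F : fieldType) (T : etensor R F)
    (N : nat) : etensor R F :=
  @ETensor R F (ptensor_pow T N)
    (fun rho s => \prod_(l < N) @est R F T rho (annot_at s l)).

(** * Partition-restricted value *)

(* The default 0 of the maximum is attained, by zeroing all variables. *)
Definition max_disjoint_value (R : realType) (F : fieldType) (T : etensor R F)
    (rho : R) : R :=
  \big[Num.max/0]_(A : kept T | strongly_disjoint (supp (prestrict A)))
    \sum_(s in supp (prestrict A)) @est R F T rho s.

(* V^pr_(rho, 3N) *)
Definition Vpr_pow (R : realType) (F : fieldType) (T : etensor R F)
    (rho : R) (N : nat) : R :=
  max_disjoint_value
    (etensor_pow (etensor_prod (etensor_prod T (etensor_rot T))
                               (etensor_rot (etensor_rot T))) N) rho.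

Definition Vpr (R : realType) (F : fieldType) (T : etensor R F) (rho : R) : R :=
  limn (fun N : nat => Vpr_pow T rho N `^ ((3 * N)%:R^-1)).

(** * Merging value *)

Definition supp_mm (F : fieldType) (T : ptensor F) : {set annot T} :=
  [set s in supp T | `[< is_matmul (constituent s) >]].

Definition supp_nmm (F : fieldType) (T : ptensor F) : {set annot T} :=
  supp T :\: supp_mm T.

(* [None] stands for the symbol 0. *)
Definition mpattern (F : fieldType) (T : ptensor F) (N : nat) : finType :=
  {ffun 'I_N -> option (annot T)}.

Definition is_pattern (F : fieldType) (T : ptensor F) (N : nat)
    (pi : mpattern T N) : bool :=
  [forall l, if pi l is Some t then t \in supp_nmm T else true].

Definition conforms (F : fieldType) (T : ptensor F) (N : nat)
    (s : annot (ptensor_pow T N)) (pi : mpattern T N) : bool :=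
  [forall l, if pi l is Some t then annot_at s l == t else annot_at s l \in supp_mm T].

Definition common_pattern (F : fieldType) (T : ptensor F) (N : nat)
    (S : {set annot (ptensor_pow T N)}) (pi : mpattern T N) : bool :=
  is_pattern pi && [forall s in S, conforms s pi].

Definition zero_pos (F : fieldType) (T : ptensor F) (N : nat) (pi : mpattern T N) :
  finType := {l : 'I_N | pi l == None}.

(* The sum of the T^(0)_s for s in S, as a tensor over the union of their
   variable sets. *)
Definition merged (F : fieldType) (T : ptensor F) (N : nat)
    (S : {set annot (ptensor_pow T N)}) (pi : mpattern T N) :=
  @tensor_sub F
    {ffun zero_pos pi -> xvar T} {ffun zero_pos pi -> yvar T}
    {ffun zero_pos pi -> zvar T}
    (fun x y z =>
       \sum_(s in S)
         tensor_family
           (fun l : zero_pos pi => constituent0 (annot_at s (\val l))) x y z)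
    (\bigcup_(s in S) [set x : {ffun zero_pos pi -> xvar T} |
       [forall l, x l \in xblock (annot_at s (\val l)).1.1]])
    (\bigcup_(s in S) [set y : {ffun zero_pos pi -> yvar T} |
       [forall l, y l \in yblock (annot_at s (\val l)).1.2]])
    (\bigcup_(s in S) [set z : {ffun zero_pos pi -> zvar T} |
       [forall l, z l \in zblock (annot_at s (\val l)).2]]).
Arguments merged {F T N} S pi.

Definition consistent (F : fieldType) (T : ptensor F) (N : nat)
    (S : {set annot (ptensor_pow T N)}) : Prop :=
  exists2 pi : mpattern T N, common_pattern S pi & is_matmul (merged S pi).

(* A nonempty set of annotations has at most one common pattern, so the choice
   made by [pick] is immaterial for consistent sums. *)
Definition merged_value (R : realType) (F : fieldType) (T : etensor R F)
    (N : nat) (rho : R) (S : {set annot (ptensor_pow T N)}) : R :=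
  if [pick pi : mpattern T N | common_pattern S pi] is Some pi then
    (volume (merged S pi))%:R `^ (rho / 3) *
    \prod_(l < N) (if pi l is Some t then @est R F T rho t else 1)
  else 0.

Definition sum_xvars (F : fieldType) (T : ptensor F) (S : {set annot T}) :
  {set xvar T} := \bigcup_(s in S) xblock s.1.1.
Definition sum_yvars (F : fieldType) (T : ptensor F) (S : {set annot T}) :
  {set yvar T} := \bigcup_(s in S) yblock s.1.2.
Definition sum_zvars (F : fieldType) (T : ptensor F) (S : {set annot T}) :
  {set zvar T} := \bigcup_(s in S) zblock s.2.

Definition consistent_restriction (F : fieldType) (T : ptensor F) (N : nat)
    (A : kept (ptensor_pow T N)) (P : {set {set annot (ptensor_pow T N)}}) :
    Prop :=
  [/\ finset.partition P (supp (prestrict A)),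
      forall S, S \in P -> consistent S &
      forall S S', S \in P -> S' \in P -> S != S' ->
        [/\ [disjoint sum_xvars S & sum_xvars S'],
            [disjoint sum_yvars S & sum_yvars S'] &
            [disjoint sum_zvars S & sum_zvars S']]].

Definition Vm_pow (R : realType) (F : fieldType) (T : etensor R F)
    (rho : R) (N : nat) : R :=
  \big[Num.max/0]_(AP : kept (ptensor_pow T N) *
                        {set {set annot (ptensor_pow T N)}} |
                   `[< consistent_restriction AP.1 AP.2 >])
    \sum_(S in AP.2) merged_value rho S.

Definition Vm (R : realType) (F : fieldType) (T : etensor R F) (rho : R) : R :=
  limn (fun N : nat => Vm_pow T rho N `^ (N%:R^-1)).

(** * Repartitioning *)

Section Repartition.
Variables (R : realType) (F : fieldType).
Variables (T : etensor R F) (I J K : finType).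
Variables (fx : xidx T -> I) (fy : yidx T -> J) (fz : zidx T -> K).

Definition coarsen_ptensor : ptensor F :=
  @PTensor F (xvar T) (yvar T) (zvar T) I J K
    (fun x => fx (xpart x)) (fun y => fy (ypart y)) (fun z => fz (zpart z))
    (@coef F T).

(* The coarse constituent with annotation s, carrying the partition and the
   estimates inherited from T. *)
Definition coarse_block (s : annot coarsen_ptensor) : etensor R F :=
  @ETensor R F
    (@PTensor F
      {x : xvar T | fx (xpart x) == s.1.1}
      {y : yvar T | fy (ypart y) == s.1.2}
      {z : zvar T | fz (zpart z) == s.2}
      {u : xidx T | fx u == s.1.1}
      {v : yidx T | fy v == s.1.2}
      {w : zidx T | fz w == s.2}
      (fun x => exist (fun u => fx u == s.1.1) (xpart (sval x)) (svalP x))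
      (fun y => exist (fun v => fy v == s.1.2) (ypart (sval y)) (svalP y))
      (fun z => exist (fun w => fz w == s.2) (zpart (sval z)) (svalP z))
      (fun x y z => coef (sval x) (sval y) (sval z)))
    (fun rho t => @est R F T rho (sval t.1.1, sval t.1.2, sval t.2)).

Definition coarsen : etensor R F :=
  @ETensor R F coarsen_ptensor
    (fun rho s =>
       if `[< is_matmul (constituent s) >]
       then (volume (constituent s))%:R `^ (rho / 3)
       else Vpr (coarse_block s) rho).

End Repartition.

(* The repartitioning with blocks x(i) = fx^-1(i), y(j) = fy^-1(j),
   z(k) = fz^-1(k). *)
Definition repartition (R : realType) (F : fieldType) (T T' : etensor R F)
    (I J K : finType) (fx : xidx T * xidx T' -> I) (fy : yidx T * yidx T' -> J)
    (fz : zidx T * zidx T' -> K) : etensor R F :=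
  @coarsen R F (etensor_prod T T') I J K fx fy fz.

(** * The Coppersmith-Winograd tensor *)

Definition monomial (F : fieldType) (n : nat) (a b c : nat) :
    tensor F 'I_n 'I_n 'I_n :=
  fun x y z => [&& x == a :> nat, y == b :> nat & z == c :> nat]%:R.
Arguments monomial F {n} a b c.

Definition cw_coef (F : fieldType) (q : nat) :
    tensor F 'I_q.+2 'I_q.+2 'I_q.+2 :=
  fun x y z =>
    \sum_(1 <= i < q.+1)
      (monomial F 0 i i x y z + monomial F i 0 i x y z +
       monomial F i i 0 x y z) +
    monomial F 0 0 q.+1 x y z + monomial F 0 q.+1 0 x y z +
    monomial F q.+1 0 0 x y z.

Definition cw_part (q : nat) (x : 'I_q.+2) : 'I_3 :=
  if x == 0 :> nat then inord 0
  else if x == q.+1 :> nat then inord 2 else inord 1.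

Definition cw_ptensor (F : fieldType) (q : nat) : ptensor F :=
  @PTensor F 'I_q.+2 'I_q.+2 'I_q.+2 'I_3 'I_3 'I_3
    (@cw_part q) (@cw_part q) (@cw_part q) (@cw_coef F q).

Definition cw (R : realType) (F : fieldType) (q : nat) : etensor R F :=
  @ETensor R F (cw_ptensor F q)
    (fun rho s => (volume (constituent s))%:R `^ (rho / 3)).

(* Main.v *)
Require Import Defs.
From mathcomp Require Import all_boot all_order all_algebra.
From mathcomp Require Import all_classical all_reals all_analysis.
From mathcomp Require Import zify ring lra.
Import Order.TTheory GRing.Theory Num.Theory.
Import numFieldNormedType.Exports.
Local Open Scope ring_scope.

(** The merging value of powers of [T_cw] is supermultiplicative, so
    [Vm_pow N <= Vm ^ N]; it suffices to merge within a power of [T_cw] almost as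
    much value as an optimal restriction of [(T~ * T~rot * T~rot2)^N] has.
    Among the constituents of such a restriction, those whose numbers of
    occurrences of every block of [T~] in every rotation agree with the most
    valuable choice of these numbers lose only a factor polynomial in [N].  In the
    product of this part with its two rotations, every constituent contains each
    block [b] equally often in its three rotations, say [n_b] times.  If [b] is a
    matrix multiplication tensor, all of it is merged into one class; otherwise
    the [n_b] copies of [b * brot * brot2] are cut down by a restriction that is
    nearly optimal for [Vpr b].  As [T_cw] is invariant under rotation, all of
    this takes place in a power of [T_cw] itself, with [18 N] factors.  *)

(** * Matrix multiplication blocks *)

(** The gain lies in the matrix multiplication blocks: the value of [T~] credits such a block with
    its full volume, although it may consist of several constituents of the square that are not
    strongly disjoint. Merging keeps them together. The obstacle is that a restriction may use a
    block unequally often in its three rotations, while [Vpr b] speaks of equal numbers of [b],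
    [brot] and [brot2]. Three rotated copies repair this: inner rotation [r] in copy [c] counts as
    rotation [c + r] modulo 3, so every total rotation receives the sum of the three counts. This
    cubes the value and explains 18 = 3 copies * 3 rotations * 2 factors of [T_cw]. The [n_b] cannot
    be prescribed, so the bound for a block has to hold for all counts at once: [Vpr b] is
    approached up to a factor [dl < 1] per block, and the finitely many counts too small for this
    are absorbed by a constant independent of [N]. Exponential growth beats this constant and the
    number of types, and [dl] may be taken arbitrarily close to 1. *)

Record mm_param (X : finType) := MMParam {
  mm_row : finType; mm_mid : finType; mm_col : finType;
  mm_x : mm_row * mm_mid -> X;
  mm_y : mm_mid * mm_col -> X;
  mm_z : mm_col * mm_row -> X }.
Arguments MMParam {X mm_row mm_mid mm_col}.
Arguments mm_row {X}. Arguments mm_mid {X}. Arguments mm_col {X}.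
Arguments mm_x {X}. Arguments mm_y {X}. Arguments mm_z {X}.

(** The matrix positions are embedded into the ambient variable set, and [P], [Q], [S] are the
    images. With arbitrary finite index types and predicates instead of ordinals and subtypes,
    products, families and rotations need no transport. One set [X] serves all axes because the
    tensors of interest are invariant under rotation. *)
Definition parametrizes {F : fieldType} {X : finType} (w : mm_param X)
    (t : tensor F X X X) (P Q S : pred X) (v : nat) : Prop :=
  [/\ (0 < v)%N /\ v = (#|mm_row w| * #|mm_mid w| * #|mm_col w|)%N,
      [/\ injective (mm_x w), injective (mm_y w) & injective (mm_z w)],
      [/\ forall x, P x <-> exists a, mm_x w a = x,
          forall y, Q y <-> exists b, mm_y w b = y &
          forall z, S z <-> exists c, mm_z w c = z] &
      forall a b c, t (mm_x w a) (mm_y w b) (mm_z w c) =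
        [&& a.2 == b.1, b.2 == c.1 & c.2 == a.1]%:R].

Definition mm_on {F : fieldType} {X : finType} (t : tensor F X X X)
    (P Q S : pred X) (v : nat) : Prop :=
  exists w, parametrizes w t P Q S v.

Section MatmulOn.
Context {F : fieldType}.

Lemma mm_on_gt0 {X : finType} {t : tensor F X X X} {P Q S v} :
  mm_on t P Q S v -> (0 < v)%N.
Proof. by case=> w [[]]. Qed.

Lemma mm_on_rot {X : finType} (t : tensor F X X X) P Q S v :
  mm_on t P Q S v -> mm_on (fun y z x => t x y z) Q S P v.
Proof.
case=> -[A B C f g h] [/= [v0 ve]] [fi gi hi] [hf hg hh] ht.
exists (MMParam g h f); split=> //=; first by rewrite v0 ve -mulnA mulnC.
by move=> a b c; rewrite ht andbC -andbA.
Qed.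

Lemma mm_on_eq {X : finType} {t : tensor F X X X} (t' : tensor F X X X)
    {P Q S : pred X} (P' Q' S' : pred X) {v} :
  (forall x y z, P x -> Q y -> S z -> t x y z = t' x y z) ->
  P =1 P' -> Q =1 Q' -> S =1 S' ->
  mm_on t P Q S v -> mm_on t' P' Q' S' v.
Proof.
move=> tt' PP QQ SS [w [h1 h2 [hf hg hh] ht]]; exists w; split=> //.
  by split=> x; rewrite -?PP -?QQ -?SS.
by move=> a b c; rewrite -tt' //; [apply/hf|apply/hg|apply/hh]; eexists.
Qed.

(** Since the volume is positive, the index that [x] leaves open has some value, and it completes
    [x] to a nonzero coefficient. *)
Lemma mm_on_x {X : finType} {t : tensor F X X X} {P Q S v} x :
  mm_on t P Q S v -> P x -> exists y z, [/\ Q y, S z & t x y z != 0].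
Proof.
case=> -[A B C f g h] [/= [v0 ve]] [fi gi hi] [hf hg hh] ht /hf [[a b] <-].
move: v0; rewrite ve !muln_gt0 => /andP[_ /card_gt0P [c _]].
exists (g (b, c)), (h (c, a)); split; first by apply/hg; exists (b, c).
  by apply/hh; exists (c, a).
by rewrite ht /= !eqxx oner_eq0.
Qed.

Lemma mm_on_y {X : finType} {t : tensor F X X X} {P Q S v} y :
  mm_on t P Q S v -> Q y -> exists x z, [/\ P x, S z & t x y z != 0].
Proof.
move=> /mm_on_rot m Qy; have [z [x [Sz Px tn]]] := mm_on_x y m Qy.
by exists x, z.
Qed.

Lemma mm_on_z {X : finType} {t : tensor F X X X} {P Q S v} z :
  mm_on t P Q S v -> S z -> exists x y, [/\ P x, Q y & t x y z != 0].
Proof.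
move=> /mm_on_rot m Qy; have [x [y [Sz Px tn]]] := mm_on_y z m Qy.
by exists y, x.
Qed.

Lemma mm_on_ex {X : finType} {t : tensor F X X X} {P Q S v} :
  mm_on t P Q S v -> exists x y z, [/\ P x, Q y, S z & t x y z != 0].
Proof.
move=> m; have v0 := mm_on_gt0 m.
have [x Px] : exists x, P x.
  case: m => -[A B C f g h] [/= [_ ve]] [fi gi hi] [hf hg hh] ht.
  move: v0; rewrite ve !muln_gt0 => /andP[/andP[/card_gt0P [a _] /card_gt0P [b _]] _].
  by exists (f (a, b)); apply/hf; exists (a, b).
by have [y [z [Qy Sz tn]]] := mm_on_x x m Px; exists x, y, z.
Qed.

Lemma mm_on_prod {X X' : finType} (t : tensor F X X X) (t' : tensor F X' X' X')
    P Q S v P' Q' S' v' :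
  mm_on t P Q S v -> mm_on t' P' Q' S' v' ->
  mm_on (fun x y z : X * X' => t x.1 y.1 z.1 * t' x.2 y.2 z.2)
    (fun x => P x.1 && P' x.2) (fun y => Q y.1 && Q' y.2)
    (fun z => S z.1 && S' z.2) (v * v').
Proof.
case=> -[A B C f g h] [/= [v0 ve]] [fi gi hi] [hf hg hh] ht.
case=> -[A' B' C' f' g' h'] [/= [v0' ve']] [fi' gi' hi'] [hf' hg' hh'] ht'.
pose pr (U V U' V' Y Y' : finType) (k : U * V -> Y) (k' : U' * V' -> Y')
  (a : (U * U') * (V * V')) := (k (a.1.1, a.2.1), k' (a.1.2, a.2.2)).
have pri (U V U' V' Y Y' : finType) (k : U * V -> Y) (k' : U' * V' -> Y') :
    injective k -> injective k' -> injective (pr _ _ _ _ _ _ k k').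
  by move=> ki ki' [[a a'] [b b']] [[c c'] [d d']] [/ki[-> ->] /ki'[-> ->]].
have prim (U V U' V' Y Y' : finType) (k : U * V -> Y) (k' : U' * V' -> Y') (P0 : pred Y) (P0' : pred Y') :
    (forall x, P0 x <-> exists a, k a = x) ->
    (forall x, P0' x <-> exists a, k' a = x) ->
    forall x, P0 x.1 && P0' x.2 <-> exists a, pr _ _ _ _ _ _ k k' a = x.
  move=> hk hk' [x x'] /=; split.
    by move=> /andP[/hk [[a b] <-] /hk' [[a' b'] <-]]; exists ((a, a'), (b, b')).
  case=> -[[a a'] [b b']] [<- <-]; apply/andP; split; first by apply/hk; exists (a, b).
  by apply/hk'; exists (a', b').
exists (@MMParam _ (A * A')%type (B * B')%type (C * C')%type
  (pr _ _ _ _ _ _ f f') (pr _ _ _ _ _ _ g g') (pr _ _ _ _ _ _ h h')).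
split=> /=.
- split; first by rewrite muln_gt0 v0 v0'.
  by rewrite ve ve' !card_prod mulnACA; congr (_ * _)%N; apply: mulnACA.
- by split; apply: pri.
- by split; apply: prim.
- move=> [[a a'] [b b']] [[c c'] [d d']] [[e e'] [k k']] /=.
  rewrite ht ht' /= -natrM mulnb !xpair_eqE.
  by do !case: eqP.
Qed.

Lemma mm_on_iso {X X' : finType} {t : tensor F X X X} (phi : X -> X')
    {t' : tensor F X' X' X'} {P Q S : pred X} {v} (P' Q' S' : pred X') :
  bijective phi ->
  (forall x y z, P x -> Q y -> S z -> t' (phi x) (phi y) (phi z) = t x y z) ->
  (forall x, P' (phi x) = P x) -> (forall x, Q' (phi x) = Q x) ->
  (forall x, S' (phi x) = S x) ->
  mm_on t P Q S v -> mm_on t' P' Q' S' v.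
Proof.
move=> pb te hP hQ hS [[A B C f g h] [/= v0 [fi gi hi] [hf hg hh] ht]].
have [psi psiK phiK] := pb; have pi := bij_inj pb.
have aux (U : finType) (k : U -> X) (P0 : pred X) (P0' : pred X') :
    (forall x, P0' (phi x) = P0 x) -> (forall x, P0 x <-> exists a, k a = x) ->
    forall x, P0' x <-> exists a, phi (k a) = x.
  move=> h0 hk x; rewrite -[x]phiK h0 hk; split=> -[a].
    by move=> <-; exists a.
  by move/pi=> <-; exists a.
exists (MMParam (phi \o f) (phi \o g) (phi \o h)); split=> //=.
- by split; apply: inj_comp.
- by split; apply: aux.
- by move=> a b c; rewrite te ?ht //; [apply/hf|apply/hg|apply/hh]; eexists.
Qed.

Lemma mm_on_family {X D : finType} (t : tensor F X X X) (P Q S : D -> pred X)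
    (v : D -> nat) :
  (forall d, mm_on t (P d) (Q d) (S d) (v d)) ->
  mm_on (tensor_family (fun _ : D => t))
    (fun x => [forall d, P d (x d)]) (fun y => [forall d, Q d (y d)])
    (fun z => [forall d, S d (z d)]) (\prod_d v d).
Proof.
move=> /choice [w hw].
(* Each factor has its own index types, so the rows, middles and columns of the product are
   dependent functions on [D]. *)
pose fam (U V : D -> finType) (k : forall d, U d * V d -> X)
  (a : {dffun forall d, U d} * {dffun forall d, V d}) : {ffun D -> X} :=
  [ffun d => k d (a.1 d, a.2 d)].
have fami U V k : (forall d, injective (k d)) -> injective (fam U V k).
  move=> ki [a b] [a' b'] /ffunP e; congr (_, _); apply/ffunP => d;
  by move: (e d); rewrite !ffunE => /ki [].
have famim U V k (P0 : D -> pred X) :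
    (forall d x, P0 d x <-> exists a, k d a = x) ->
    forall x : {ffun D -> X}, [forall d, P0 d (x d)] <-> exists a, fam U V k a = x.
  move=> hk x; split.
    move=> /forallP h.
    have {}h d : {a | k d a = x d} by apply: cid; apply/hk.
    exists ([ffun d => (projT1 (h d)).1], [ffun d => (projT1 (h d)).2]).
    by apply/ffunP => d; rewrite !ffunE -surjective_pairing (projT2 (h d)).
  by case=> a <-; apply/forallP => d; rewrite ffunE; apply/hk; eexists.
exists (@MMParam _ {dffun forall d, mm_row (w d)} {dffun forall d, mm_mid (w d)}
   {dffun forall d, mm_col (w d)}
   (fam _ _ (fun d => mm_x (w d))) (fam _ _ (fun d => mm_y (w d)))
   (fam _ _ (fun d => mm_z (w d)))).
split=> /=.
- split; first by rewrite prodn_gt0 // => d; case: (hw d) => -[].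
  rewrite !card_dep_ffun !foldrE !big_map -!enumT !big_enum -!big_split /=.
  by apply: eq_bigr => d _; case: (hw d) => -[].
- by split; apply: fami => d; case: (hw d) => _ [].
- by split; apply: famim => d; case: (hw d) => _ _ [].
- move=> [a a'] [b b'] [c c'] /=; rewrite /tensor_family.
  under eq_bigr => d _ do (rewrite !ffunE; case: (hw d) => _ _ _ ->).
  have [/and3P[/= /eqP-> /eqP-> /eqP->]|n] := boolP [&& _, _ & _].
    by rewrite big1 // => d _; rewrite !eqxx.
  apply/eqP; rewrite prodf_seq_eq0; apply/hasP.
  have [d hd] : exists d, ~~ [&& a' d == b d, b' d == c d & c' d == a d].
    apply/existsP; apply: contraNT n; rewrite negb_exists => /forallP h.
    by apply/and3P; split; apply/eqP/ffunP => d; move: (h d); rewrite negbK => /and3P[/eqP ? /eqP ? /eqP ?].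
  by exists d; rewrite ?mem_index_enum //= (negbTE hd).
Qed.

(** The link with the official notion of volume: [enum_rank] turns the free index types into
    ordinals, and injections onto a set into bijections from its subtype. *)
Lemma has_volumeP {X : finType} (t : tensor F X X X) (A B C : {set X}) v :
  has_volume (tensor_sub t A B C) v <-> mm_on t (mem A) (mem B) (mem C) v.
Proof.
split.
  case=> n [m [p [n0 m0 p0 ve [f [g [h [[f' f'K fK'] [g' g'K gK'] [h' h'K hK'] e]]]]]]].
  have aux (U : finType) (E : {set X}) (k : {x | x \in E} -> U) (k' : U -> {x | x \in E}) :
      cancel k k' -> forall x, x \in E <-> exists a, val (k' a) = x.
    move=> kK x; split; first by move=> xE; exists (k (exist _ x xE)); rewrite kK.
    by case=> a <-; apply: valP.
  exists (@MMParam _ 'I_n 'I_m 'I_p (fun a => val (f' a)) (fun a => val (g' a)) (fun a => val (h' a))); split=> /=.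
  - by rewrite !card_ord ve !muln_gt0 n0 m0 p0.
  - by split; apply: inj_comp; try exact: val_inj; apply: can_inj; eassumption.
  - by split; apply: aux; eassumption.
  - by move=> a b c; have := e (f' a) (g' b) (h' c); rewrite {1}/tensor_sub fK' gK' hK' => ->.
case=> -[U V W f g h] [/= [v0 ve]] [fi gi hi] [hf hg hh] ht.
exists #|U|, #|V|, #|W|; move: v0; rewrite ve !muln_gt0 => /andP[/andP[u0 v0] w0].
split=> //.
have aux (U' V' : finType) (E : {set X}) (k : U' * V' -> X) : injective k ->
    (forall x, x \in E <-> exists a, k a = x) ->
    {k' : {x | x \in E} -> 'I_#|U'| * 'I_#|V'| | bijective k' &
       forall x a, k a = val x -> k' x = (enum_rank a.1, enum_rank a.2)}.
  move=> ki hk.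
  have hx (x : {x | x \in E}) : {a | k a = val x} by apply: cid; apply/hk/valP.
  have hk' a : k a \in E by apply/hk; exists a.
  exists (fun x => (enum_rank (projT1 (hx x)).1, enum_rank (projT1 (hx x)).2)).
    exists (fun a => exist _ (k (enum_val a.1, enum_val a.2)) (hk' _)).
      by move=> x; apply: val_inj; rewrite /= !enum_rankK -surjective_pairing (projT2 (hx x)).
    move=> [a b] /=; case: (hx _) => -[a' b'] /= /ki [-> ->].
    by rewrite !enum_valK.
  by move=> x a e; case: (hx x) => a' /= e'; move: e; rewrite -[val x]e' => /ki ->.
have [f' fb fe] := aux _ _ _ f fi hf.
have [g' gb ge] := aux _ _ _ g gi hg.
have [h' hb he] := aux _ _ _ h hi hh.
exists f', g', h'; split=> // x y z; rewrite /tensor_sub.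
have /hf [a ea] := valP x; have /hg [b eb] := valP y; have /hh [c ec] := valP z.
rewrite -ea -eb -ec ht (fe x a) // (ge y b) // (he z c) // /matmul /=.
by rewrite !(inj_eq enum_rank_inj).
Qed.

Lemma mm_on_unique {X : finType} {t : tensor F X X X} {P Q S v v'} :
  mm_on t P Q S v -> mm_on t P Q S v' -> v = v'.
Proof.
(* Counting variables gives nm * mp * pn = (nmp)^2, which determines the volume. *)
have aux w u : parametrizes w t P Q S u -> (u ^ 2 = #|P| * #|Q| * #|S|)%N.
  case: w => A B C f g h [/= [_ ->]] [fi gi hi] [hf hg hh] _.
  have im (U V : finType) (k : U * V -> X) (P0 : pred X) : injective k ->
      (forall x, P0 x <-> exists a, k a = x) -> #|P0| = (#|U| * #|V|)%N.
    move=> ki hk; rewrite -card_prod -(card_codom ki); apply: eq_card => x.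
    by apply/idP/codomP => [/hk[a <-]|[a ->]]; [exists a|apply/hk; exists a].
  rewrite (im _ _ _ _ fi hf) (im _ _ _ _ gi hg) (im _ _ _ _ hi hh) -mulnn; move: #|A| #|B| #|C| => a b c; lia.
case=> w /aux e [w' /aux e']; apply/eqP; rewrite -(@eqn_exp2r _ _ 2) //.
by rewrite e e'.
Qed.

Lemma mm_on_volume {X : finType} (t : tensor F X X X) (A B C : {set X}) v :
  mm_on t (mem A) (mem B) (mem C) v -> volume (tensor_sub t A B C) = v.
Proof.
move=> m; apply: xget_unique; first by apply/has_volumeP.
by move=> u /has_volumeP m'; apply: mm_on_unique m' m.
Qed.

Lemma is_matmulP {X : finType} (t : tensor F X X X) (A B C : {set X}) :
  is_matmul (tensor_sub t A B C) ->
  mm_on t (mem A) (mem B) (mem C) (volume (tensor_sub t A B C)).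
Proof. by case=> v /has_volumeP m; rewrite (mm_on_volume _ _ _ _ _ m). Qed.

End MatmulOn.

(** * Values achieved by disjoint blocks *)

(* The parts of the classes of a restriction, by axis.  Different classes share no
   variable as soon as there are no cross terms (second condition of
   [achieved_by]), because every variable of a matrix multiplication tensor
   occurs in it. *)
Record blocks (I : finType) := Blocks {
  bclass : finType;
  bx : bclass -> pred I; by_ : bclass -> pred I; bz : bclass -> pred I;
  bvol : bclass -> nat }.
Arguments Blocks {I}. Arguments bclass {I}. Arguments bx {I}.
Arguments by_ {I}. Arguments bz {I}. Arguments bvol {I}.

(** [PX], [PY], [PZ] confine the parts in use, so that restrictions found in separate regions can be
    put together. The number [r] is only a lower bound for the value, which makes the notion
    monotone. *)
Definition achieved_by {R : realType} (rho : R) {F : fieldType} {X I : finType}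
    (b : blocks I) (p : X -> I) (t : tensor F X X X) (PX PY PZ : pred I)
    (r : R) : Prop :=
  [/\ forall c, [/\ subpred (bx b c) PX, subpred (by_ b c) PY & subpred (bz b c) PZ],
      forall x y z c c' c'', t x y z != 0 ->
        bx b c (p x) -> by_ b c' (p y) -> bz b c'' (p z) -> c = c' /\ c = c'',
      forall c, mm_on t (preim p (bx b c)) (preim p (by_ b c))
                  (preim p (bz b c)) (bvol b c) &
      r <= \sum_c (bvol b c)%:R `^ (rho / 3)].

Definition achieves {R : realType} (rho : R) {F : fieldType} {X I : finType}
    (p : X -> I) (t : tensor F X X X) (PX PY PZ : pred I) (r : R) : Prop :=
  exists b, achieved_by rho b p t PX PY PZ r.

Section Achieves.
Context {R : realType} {rho : R} {F : fieldType}.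
Local Notation achieves := (achieves rho).

Lemma achieves_le {X I : finType} {p : X -> I} {t : tensor F X X X} {PX PY PZ}
    r r' : r' <= r -> achieves p t PX PY PZ r -> achieves p t PX PY PZ r'.
Proof.
move=> le [[C ax ay az v] [/= h1 h2 h3 h4]]; exists (Blocks C ax ay az v).
by split=> //; apply: le_trans h4.
Qed.

Lemma achieves0 {X I : finType} {p : X -> I} {t : tensor F X X X} {PX PY PZ} :
  achieves p t PX PY PZ 0.
Proof.
exists (Blocks void (fun _ => xpred0) (fun _ => xpred0) (fun _ => xpred0) (fun=> 0%N)).
by split=> [[]|||] //; rewrite big1 // => -[].
Qed.

Lemma achieves_mm {X I : finType} {p : X -> I} {t : tensor F X X X} {PX PY PZ} v :
  mm_on t (preim p PX) (preim p PY) (preim p PZ) v ->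
  achieves p t PX PY PZ (v%:R `^ (rho / 3)).
Proof.
move=> m; exists (Blocks unit (fun _ => PX) (fun _ => PY) (fun _ => PZ) (fun=> v)).
split=> [c|? ? ? [] [] []|c|] //; first by split=> ?.
by rewrite (big_pred1 tt) // => -[].
Qed.

(** Regions without cross terms can be restricted independently; a class of the union is a region
    together with a class inside it. *)
Lemma achieves_union {X I C : finType} (p : X -> I) (t : tensor F X X X)
    (ax ay az : C -> pred I) (PX PY PZ : pred I) (r : C -> R) :
  (forall c, [/\ subpred (ax c) PX, subpred (ay c) PY & subpred (az c) PZ]) ->
  (forall x y z c c' c'', t x y z != 0 ->
     ax c (p x) -> ay c' (p y) -> az c'' (p z) -> c = c' /\ c = c'') ->
  (forall c, achieves p t (ax c) (ay c) (az c) (r c)) ->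
  achieves p t PX PY PZ (\sum_c r c).
Proof.
move=> sub nc /choice [b h].
exists (Blocks {c : C & bclass (b c)} (fun c => bx (b (tag c)) (tagged c))
  (fun c => by_ (b (tag c)) (tagged c)) (fun c => bz (b (tag c)) (tagged c))
  (fun c => bvol (b (tag c)) (tagged c))); split=> /=.
- move=> [c d] /=; have [sx sy sz] := sub c; have [/(_ d)[s1 s2 s3] _ _ _] := h c.
  by split=> i /=; [move/s1/sx|move/s2/sy|move/s3/sz].
- move=> x y z [c d] [c' d'] [c'' d''] /= tn hx hy hz.
  have [/(_ d)[s1 _ _] hc _ _] := h c; have [/(_ d')[_ s2 _] _ _ _] := h c'.
  have [/(_ d'')[_ _ s3] _ _ _] := h c''.
  have [e e'] := nc x y z c c' c'' tn (s1 _ hx) (s2 _ hy) (s3 _ hz).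
  subst c' c''.
  by have [-> ->] := hc _ _ _ _ _ _ tn hx hy hz.
- by move=> [c d] /=; have [_ _ ] := h c.
- apply: (@le_trans _ _ (\sum_c \sum_d (bvol (b c) d)%:R `^ (rho / 3))).
    by apply: ler_sum => c _; have [] := h c.
  by rewrite sig_big_dep.
Qed.

(** [psi] runs against [phi] because the predicates on parts are pulled back along it. *)
Lemma achieves_iso {X X' I I' : finType} {p : X -> I} {p' : X' -> I'}
    (phi : X -> X') (psi : I' -> I) {t : tensor F X X X} {t' : tensor F X' X' X'}
    {PX PY PZ : pred I} (PX' PY' PZ' : pred I') r :
  bijective phi ->
  (forall x y z, t' (phi x) (phi y) (phi z) = t x y z) ->
  (forall x, psi (p' (phi x)) = p x) ->
  (forall i, PX (psi i) -> PX' i) -> (forall i, PY (psi i) -> PY' i) ->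
  (forall i, PZ (psi i) -> PZ' i) ->
  achieves p t PX PY PZ r -> achieves p' t' PX' PY' PZ' r.
Proof.
move=> pb te pe hX hY hZ [[C ax ay az v] [/= h1 h2 h3 h4]].
have [phi' phiK phi'K] := pb.
exists (Blocks C (fun c => ax c \o psi) (fun c => ay c \o psi) (fun c => az c \o psi) v).
split=> //.
- by move=> c; have [s1 s2 s3] := h1 c; split=> i /=;
    [move/s1/hX|move/s2/hY|move/s3/hZ].
- move=> x y z c c' c''; rewrite -[x]phi'K -[y]phi'K -[z]phi'K te /= !pe; exact: h2.
- by move=> c; move: (h3 c); apply: (mm_on_iso phi _ _ _ pb (fun x y z _ _ _ => te x y z)) => x /=; rewrite pe.
Qed.

Lemma achieves_prod {X X' I I' : finType} (p : X -> I) (p' : X' -> I')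
    (t : tensor F X X X) (t' : tensor F X' X' X') PX PY PZ PX' PY' PZ' r r' :
  0 <= r -> 0 <= r' ->
  achieves p t PX PY PZ r -> achieves p' t' PX' PY' PZ' r' ->
  achieves (fun x : X * X' => (p x.1, p' x.2))
    (fun x y z => t x.1 y.1 z.1 * t' x.2 y.2 z.2)
    (fun i => PX i.1 && PX' i.2) (fun i => PY i.1 && PY' i.2)
    (fun i => PZ i.1 && PZ' i.2) (r * r').
Proof.
move=> r0 r0' [[C ax ay az v] [/= h1 h2 h3 h4]].
move=> [[C' ax' ay' az' v'] [/= h1' h2' h3' h4']].
exists (Blocks (C * C')%type (fun c i => ax c.1 i.1 && ax' c.2 i.2)
  (fun c i => ay c.1 i.1 && ay' c.2 i.2) (fun c i => az c.1 i.1 && az' c.2 i.2)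
  (fun c => v c.1 * v' c.2)%N); split.
- move=> [c c']; have [s1 s2 s3] := h1 c; have [s1' s2' s3'] := h1' c'.
  by split=> -[i i'] /= /andP[]; [move=> /s1-> /s1'->|move=> /s2-> /s2'->|move=> /s3-> /s3'->].
- move=> [x x'] [y y'] [z z'] [c d] [c' d'] [c'' d''] /=.
  rewrite mulf_eq0 negb_or => /andP[n n'] /andP[a a'] /andP[b b'] /andP[k k'].
  by have [-> ->] := h2 _ _ _ _ _ _ n a b k; have [-> ->] := h2' _ _ _ _ _ _ n' a' b' k'.
- by move=> [c c']; exact: (mm_on_prod _ _ _ _ _ _ _ _ _ _ (h3 c) (h3' c')).
- apply: (le_trans (ler_pM r0 r0' h4 h4')).
  rewrite big_distrlr /= pair_bigA /=; apply: ler_sum => -[c c'] _ /=.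
  by rewrite natrM powRM.
Qed.

End Achieves.

(** * Powers with a separate constraint on each factor *)

Definition ffun_part (D : finType) {X I : finType} (p : X -> I)
    (x : {ffun D -> X}) : {ffun D -> I} := [ffun d => p (x d)].

(** Constraints given factor by factor survive reordering and regrouping of the factors, which are
    indexed by an arbitrary finite type [D] for that purpose. *)
Definition family_achieves {R : realType} (rho : R) {F : fieldType}
    {X I : finType} (p : X -> I) (t : tensor F X X X) (D : finType)
    (qx qy qz : D -> pred I) (r : R) : Prop :=
  achieves rho (ffun_part D p) (tensor_family (fun _ : D => t))
    (fun i => [forall d, qx d (i d)]) (fun i => [forall d, qy d (i d)])
    (fun i => [forall d, qz d (i d)]) r.

Lemma powR_natr_prod {R : realType} {D : finType} (v : D -> nat) (a : R) :
  (\prod_d v d)%:R `^ a = \prod_d (v d)%:R `^ a.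
Proof.
rewrite natr_prod.
(* Real powers are multiplicative on nonnegative bases, so nonnegativity of the partial products is
   carried through the induction. *)
suff [_ ->] : 0 <= \prod_d (v d)%:R :> R /\
  (\prod_d (v d)%:R) `^ a = \prod_d (v d)%:R `^ a by [].
elim/big_rec2: _ => [|d x y _ [y0 <-]]; first by rewrite powR1.
by rewrite mulr_ge0 // powRM.
Qed.

Section FamilyAchieves.
Context {R : realType} {rho : R} {F : fieldType} {X I : finType}.
Context {p : X -> I} {t : tensor F X X X}.
Local Notation fachieves := (family_achieves rho p t).

Lemma family_achieves_iso {D D' : finType} (e : D' -> D) (qx qy qz : D -> pred I)
    (qx' qy' qz' : D' -> pred I) r :
  bijective e -> (forall d, qx' d =1 qx (e d)) -> (forall d, qy' d =1 qy (e d)) ->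
  (forall d, qz' d =1 qz (e d)) ->
  fachieves D' qx' qy' qz' r -> fachieves D qx qy qz r.
Proof.
move=> [e' eK e'K] hx hy hz.
have aux (q : D -> pred I) (q' : D' -> pred I) : (forall d, q' d =1 q (e d)) ->
    forall i : {ffun D -> I}, [forall d, q' d ([ffun d => i (e d)] d)] -> [forall d, q d (i d)].
  by move=> h i /forallP h'; apply/forallP => d; have := h' (e' d); rewrite ffunE h e'K.
apply: (achieves_iso (fun x : {ffun D' -> X} => [ffun d => x (e' d)]) (fun i : {ffun D -> I} => [ffun d => i (e d)])).
- exists (fun x : {ffun D -> X} => [ffun d => x (e d)]) => x; apply/ffunP => d; rewrite !ffunE ?eK ?e'K //.
- move=> x y z; rewrite /tensor_family (reindex e) /=; last by exists e' => ? _.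
  by apply: eq_bigr => d _; rewrite !ffunE !eK.
- by move=> x; apply/ffunP => d; rewrite !ffunE eK.
- exact: aux.
- exact: aux.
- exact: aux.
Qed.

Lemma family_achieves_sum {D D' : finType} (qx qy qz : D + D' -> pred I) r r' :
  0 <= r -> 0 <= r' ->
  fachieves D (qx \o inl) (qy \o inl) (qz \o inl) r ->
  fachieves D' (qx \o inr) (qy \o inr) (qz \o inr) r' ->
  fachieves (D + D')%type qx qy qz (r * r').
Proof.
move=> r0 r0' h h'; have := achieves_prod _ _ _ _ _ _ _ _ _ _ _ _ r0 r0' h h'.
have aux (q : D + D' -> pred I) : forall i : {ffun D + D' -> I},
  [forall d, (q \o inl) d ([ffun d => i (inl d)] d)] &&
  [forall d, (q \o inr) d ([ffun d => i (inr d)] d)] -> [forall d, q d (i d)].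
  move=> i /andP[/forallP h1 /forallP h2]; apply/forallP => -[] d.
    by have := h1 d; rewrite ffunE.
  by have := h2 d; rewrite ffunE.
apply: (achieves_iso (fun x : {ffun D -> X} * {ffun D' -> X} =>
    [ffun d => match d with inl d => x.1 d | inr d => x.2 d end])
  (fun i : {ffun D + D' -> I} => ([ffun d => i (inl d)], [ffun d => i (inr d)]))).
- exists (fun x : {ffun D + D' -> X} => ([ffun d => x (inl d)], [ffun d => x (inr d)])).
    by move=> [x x']; congr (_, _); apply/ffunP => d; rewrite !ffunE.
  by move=> x; apply/ffunP => -[] d; rewrite !ffunE.
- move=> x y z; rewrite /tensor_family big_sumType /=.
  by congr (_ * _); apply: eq_bigr => d _; rewrite !ffunE.
- by move=> [x x']; congr (_, _); apply/ffunP => d; rewrite !ffunE.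
- exact: aux.
- exact: aux.
- exact: aux.
Qed.

Lemma family_achieves_split {D : finType} (k : pred D) (qx qy qz : D -> pred I) r r' :
  0 <= r -> 0 <= r' ->
  fachieves {d | k d} (qx \o val) (qy \o val) (qz \o val) r ->
  fachieves {d | ~~ k d} (qx \o val) (qy \o val) (qz \o val) r' ->
  fachieves D qx qy qz (r * r').
Proof.
move=> r0 r0' h h'.
pose e (d : {d | k d} + {d | ~~ k d}) := match d with inl d => val d | inr d => val d end.
apply: (family_achieves_iso e _ _ _ (qx \o e) (qy \o e) (qz \o e)) => //.
  pose e' d : {d | k d} + {d | ~~ k d} :=
    match boolP (k d) with AltTrue h => inl (exist _ d h) | AltFalse h => inr (exist _ d h) end.
  exists e' => [[d|d]|d]; rewrite /e' /=; case: {-}_ / (boolP (k _)) => h0 //.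
  - by congr inl; apply: val_inj.
  - by case/negP: h0; case: d.
  - by case/negP: (valP d).
  - by congr inr; apply: val_inj.
exact: family_achieves_sum.
Qed.

Lemma family_mm_on {D : finType} (qx qy qz : D -> pred I) v :
  (forall d, mm_on t (preim p (qx d)) (preim p (qy d)) (preim p (qz d)) (v d)) ->
  mm_on (tensor_family (fun _ : D => t))
    (preim (ffun_part D p) (fun i => [forall d, qx d (i d)]))
    (preim (ffun_part D p) (fun i => [forall d, qy d (i d)]))
    (preim (ffun_part D p) (fun i => [forall d, qz d (i d)])) (\prod_d v d).
Proof.
move/mm_on_family; apply: mm_on_eq => // x /=; by under [RHS]eq_forallb do rewrite ffunE.
Qed.


Lemma family_achieves_mm {D : finType} (qx qy qz : D -> pred I) v :
  (forall d, mm_on t (preim p (qx d)) (preim p (qy d)) (preim p (qz d)) (v d)) ->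
  fachieves D qx qy qz (\prod_d (v d)%:R `^ (rho / 3)).
Proof.
by move/family_mm_on/achieves_mm => /(_ R rho); rewrite powR_natr_prod.
Qed.

End FamilyAchieves.

(** * The Coppersmith-Winograd tensor *)

Lemma mm_on_cyclic {F : fieldType} {X : finType} {t : tensor F X X X}
    {P Q S : pred X} {v} :
  (forall x y z, t x y z = t y z x) -> mm_on t P Q S v -> mm_on t Q S P v.
Proof. by move=> tC /mm_on_rot; apply: mm_on_eq => // x y z _ _ _; rewrite tC. Qed.

Section CoppersmithWinograd.
Variables (F : fieldType) (q : nat).
Local Notation t := (@cw_coef F q).
Local Notation pt := (@cw_part q).


(** The cast of a natural number built from boolean tests: cyclic symmetry and nonvanishing then
    reduce to case analysis. *)
Lemma cw_coefE (x y z : 'I_q.+2) :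
  t x y z = (([&& x == 0 :> nat, y == z & 0 < y < q.+1] +
              [&& y == 0 :> nat, z == x & 0 < z < q.+1] +
              [&& z == 0 :> nat, x == y & 0 < x < q.+1] +
              [&& x == 0 :> nat, y == 0 :> nat & z == q.+1 :> nat] +
              [&& x == 0 :> nat, y == q.+1 :> nat & z == 0 :> nat] +
              [&& x == q.+1 :> nat, y == 0 :> nat & z == 0 :> nat])%N)%:R.
Proof.
rewrite /cw_coef /monomial !natrD; do 3 congr (_ + _).
have sumE (a b : nat) (c : bool) :
    \sum_(1 <= i < q.+1) [&& c, a == i & b == i]%:R =
    [&& c, a == b & 0 < a < q.+1]%N%:R :> F.
  have [h|h] := boolP (0 < a < q.+1)%N.
    rewrite (bigD1_seq a) ?mem_index_iota ?iota_uniq //= big1 ?addr0.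
      by rewrite eqxx andbT /= eq_sym.
    by move=> i /negbTE; rewrite eq_sym => ->; rewrite andbF.
  rewrite big_nat big1 ?andbF // => i hi; case: eqP => [e|_]; last by rewrite andbF.
  by rewrite e hi in h.
rewrite !big_split /=; congr (_ + _ + _).
- by rewrite sumE.
- under eq_bigr => i _ do rewrite andbC -andbA andbC -andbA andbCA.
  by rewrite -sumE; apply: eq_bigr => i _; do !case: eqP.
- by rewrite -sumE; apply: eq_bigr => i _; do !case: eqP.
Qed.

Lemma cw_coef_cyclic x y z : t x y z = t y z x.
Proof. rewrite !cw_coefE; congr (_%:R); do !case: eqP; lia. Qed.

Lemma cw_part0 (x y : 'I_q.+2) : x = 0%N :> nat -> (pt y == pt x) = (y == x).
Proof.
move=> x0; rewrite /cw_part x0 eqxx -!(inj_eq val_inj) /= x0.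
case: (_ == 0 :> nat); first by rewrite eqxx.
by case: ifP => _; rewrite !inordK.
Qed.

Lemma cw_part2 (x y : 'I_q.+2) : x = q.+1 :> nat -> (pt y == pt x) = (y == x).
Proof.
move=> x0; rewrite /cw_part x0 eqxx -!(inj_eq val_inj) /= x0.
have [->|_] := eqVneq (y : nat) q.+1; first by rewrite eqxx.
by case: ifP => _; rewrite !inordK.
Qed.

Lemma cw_part1 (x y : 'I_q.+2) : (0 < x < q.+1)%N -> (pt y == pt x) = (0 < y < q.+1)%N.
Proof.
have := ltn_ord y; rewrite /cw_part => ? ?.
have [e|_] := eqVneq (x : nat) 0%N; first by lia.
have [e|_] := eqVneq (x : nat) q.+1; first by lia.
have [e|n] := eqVneq (y : nat) 0%N; first by rewrite -(inj_eq val_inj) /= !inordK //; move: e; lia.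
have [e|n'] := eqVneq (y : nat) q.+1; first by rewrite -(inj_eq val_inj) /= !inordK //; move: e; lia.
by rewrite eqxx; lia.
Qed.

Definition cw_mm_at (x y z : 'I_q.+2) : Prop :=
  exists v, mm_on t (fun x' => pt x' == pt x) (fun y' => pt y' == pt y)
              (fun z' => pt z' == pt z) v.

Lemma cw_mm_at_cyclic x y z : cw_mm_at x y z -> cw_mm_at y z x.
Proof. by case=> v m; exists v; apply: mm_on_cyclic m; apply: cw_coef_cyclic. Qed.

(** The block with terms [x_0 y_i z_i], for i from 1 to q, has one row, one middle index and q
    columns; column [c] stands for i = [c.+1]. *)
Lemma cw_mm_at_011 (x y : 'I_q.+2) : x = 0%N :> nat -> (0 < y < q.+1)%N -> cw_mm_at x y y.
Proof.
move=> x0 hy; exists q.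
have f0 (c : 'I_q) : (c.+1 < q.+2)%N by have := ltn_ord c; lia.
pose g c := Ordinal (f0 c).
have gi : injective g by move=> c d /(congr1 val) [] /val_inj.
exists (@MMParam _ unit unit 'I_q (fun=> x) (fun b => g b.2) (fun c => g c.1)).
split=> /=.
- by split; [lia|rewrite !card_unit card_ord !mul1n].
- split; first by move=> [[] []] [[] []].
    by move=> [[] c] [[] d] /gi /= ->.
  by move=> [c []] [d []] /gi /= ->.
- have hg (z : 'I_q.+2) : (0 < z < q.+1)%N -> exists c, g c = z.
    move=> hz; have h : (z.-1 < q)%N by lia.
    by exists (Ordinal h); apply: val_inj => /=; lia.
  split=> z; rewrite ?(cw_part0 x z x0) ?(cw_part1 y z hy); split.
  + by move/eqP->; exists (tt, tt).
  + by case=> _ ->.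
  + by move/hg => [c <-]; exists (tt, c).
  + by case=> -[[] c] <- /=; have := ltn_ord c; lia.
  + by move/hg => [c <-]; exists (c, tt).
  + by case=> -[c []] <- /=; have := ltn_ord c; lia.
- move=> [[] []] [[] c] [d []]; rewrite cw_coefE x0 /= -(inj_eq val_inj) /= !eqxx andbT eqSS val_eqE.
  by rewrite ltnS ltn_ord andbT andbF !addn0.
Qed.

Lemma cw_mm_at_002 (x y z : 'I_q.+2) :
  x = 0%N :> nat -> y = 0%N :> nat -> z = q.+1 :> nat -> cw_mm_at x y z.
Proof.
move=> x0 y0 z0; exists 1%N.
exists (@MMParam _ unit unit unit (fun=> x) (fun=> y) (fun=> z)); split=> /=.
- by rewrite !card_unit.
- by split=> -[[] []] [[] []].
- split=> w; rewrite ?(cw_part0 x w x0) ?(cw_part0 y w y0) ?(cw_part2 z w z0).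
  by split=> [/eqP->|[_ ->]] //; exists (tt, tt).
  by split=> [/eqP->|[_ ->]] //; exists (tt, tt).
  by split=> [/eqP->|[_ ->]] //; exists (tt, tt).
- by move=> [[] []] [[] []] [[] []]; rewrite cw_coefE x0 y0 z0 /= -!(inj_eq val_inj) /= x0 y0 z0 !eqxx.
Qed.

(** Up to rotation there are only the blocks (0,1,1) and (0,0,2). *)
Lemma cw_mm (x y z : 'I_q.+2) : t x y z != 0 -> cw_mm_at x y z.
Proof.
rewrite cw_coefE.
have [/and3P[/eqP ? /eqP <- ?]|_] := boolP [&& x == 0 :> nat, y == z & _].
  by move=> _; apply: cw_mm_at_011.
have [/and3P[/eqP ? /eqP <- ?]|_] := boolP [&& y == 0 :> nat, z == x & _].
  by move=> _; do 2 apply: cw_mm_at_cyclic; apply: cw_mm_at_011.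
have [/and3P[/eqP ? /eqP <- ?]|_] := boolP [&& z == 0 :> nat, x == y & _].
  by move=> _; apply: cw_mm_at_cyclic; apply: cw_mm_at_011.
have [/and3P[/eqP ? /eqP ? /eqP ?]|_] := boolP [&& x == 0 :> nat, y == 0 :> nat & _].
  by move=> _; apply: cw_mm_at_002.
have [/and3P[/eqP ? /eqP ? /eqP ?]|_] := boolP [&& x == 0 :> nat, y == q.+1 :> nat & _].
  by move=> _; apply: cw_mm_at_cyclic; apply: cw_mm_at_002.
have [/and3P[/eqP ? /eqP ? /eqP ?]|_] := boolP [&& x == q.+1 :> nat, y == 0 :> nat & _].
  by move=> _; do 2 apply: cw_mm_at_cyclic; apply: cw_mm_at_002.
by rewrite eqxx.
Qed.


End CoppersmithWinograd.

(** * Merging in powers *)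

Lemma suppP {F : fieldType} {T : ptensor F} {s : annot T} :
  reflect (exists x y z, [/\ xpart x = s.1.1, ypart y = s.1.2, zpart z = s.2 &
                             coef x y z != 0]) (s \in supp T).
Proof.
rewrite inE; apply: (iffP existsP).
  move=> [x /andP[]]; rewrite inE => /eqP hx /existsP[y /andP[]].
  by rewrite inE => /eqP hy /existsP[z /andP[]]; rewrite inE => /eqP hz n; exists x, y, z.
move=> [x [y [z [hx hy hz n]]]]; exists x; rewrite inE hx eqxx /=.
apply/existsP; exists y; rewrite inE hy eqxx /=.
by apply/existsP; exists z; rewrite inE hz eqxx /=.
Qed.

Lemma supp_prestrictP {F : fieldType} {T : ptensor F} {A : kept T} {s : annot T} :
  reflect (s \in supp T /\ [/\ s.1.1 \in A.1.1, s.1.2 \in A.1.2 & s.2 \in A.2])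
    (s \in supp (prestrict A)).
Proof.
apply: (iffP suppP).
  move=> [x [y [z /= [hx hy hz]]]]; case: ifP => [/and3P[? ? ?] n|_]; last by rewrite eqxx.
  by split; [apply/suppP; exists x, y, z|rewrite -hx -hy -hz].
move=> [/suppP [x [y [z [hx hy hz n]]]] [Ax Ay Az]]; exists x, y, z.
by split=> //=; rewrite hx hy hz Ax Ay Az.
Qed.

Section CWMerging.
Context {R : realType} {rho : R} {F : fieldType} {q : nat}.
Local Notation T := (cw R F q).
Local Notation p := (@cw_part q).
Local Notation t := (@cw_coef F q).

Definition cw_achieves (D : finType) (r : R) : Prop :=
  achieves rho (ffun_part D p) (tensor_family (fun _ : D => t)) xpredT xpredT xpredT r.

Lemma cw_supp_mm (s : annot T) : s \in supp T -> is_matmul (constituent s).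
Proof.
move=> /suppP [x [y [z /= [hx hy hz]]]] /cw_mm [v m].
exists v; apply/has_volumeP; move: m; apply: mm_on_eq => // w /=; rewrite inE /= ?hx ?hy ?hz //.
Qed.

(** Hence the only pattern is constantly [None], and a sum of constituents is consistent as soon as
    it is a matrix multiplication tensor. *)
Lemma cw_supp_nmm : supp_nmm T = finset.set0.
Proof.
apply/setP => s; rewrite !inE andbC; apply/negP => /andP[h]; rewrite h /=.
by move/negP; apply; apply/asboolP/cw_supp_mm; rewrite inE.
Qed.

Section Power.
Variable N : nat.
Local Notation tN := (tensor_family (fun _ : 'I_N => t)).
Local Notation pN := (ffun_part 'I_N p).
Implicit Types (S : {set annot (ptensor_pow T N)}) (pi : mpattern T N).

Lemma cw_patternP S pi : common_pattern S pi -> forall l, pi l = None.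
Proof.
move=> /andP[/forallP h _] l; case e: (pi l) (h l) => [s|//].
by rewrite cw_supp_nmm inE.
Qed.

Lemma supp_powP (s : annot (ptensor_pow T N)) l :
  s \in supp (ptensor_pow T N) -> annot_at s l \in supp T.
Proof.
move=> /suppP [x [y [z /= [hx hy hz n]]]]; apply/suppP; exists (x l), (y l), (z l).
split; rewrite /annot_at /=; rewrite -?hx -?hy -?hz ?ffunE //.
by move: n; rewrite /tensor_family prodf_seq_neq0 => /allP /(_ l); rewrite mem_index_enum => /(_ isT).
Qed.

Lemma merged_termE (D : finType) (x y z : {ffun D -> 'I_q.+2}) (s : D -> annot T) :
  tensor_family (fun l => constituent0 (T := T) (s l)) x y z =
  if [forall l, s l == (p (x l), p (y l), p (z l))]
  then tensor_family (fun _ => t) x y z else 0.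
Proof.
rewrite /tensor_family /constituent0; case: ifPn => [/forallP h|].
  by apply: eq_bigr => l _; rewrite (eqP (h l)) !inE !eqxx.
rewrite negb_forall => /existsP [l hl]; apply/eqP; rewrite prodf_seq_eq0.
apply/hasP; exists l; first exact: mem_index_enum.
rewrite /=; case: ifP => // /and3P[]; rewrite !inE => /eqP hx /eqP hy /eqP hz.
by move: hx hy hz hl => /= hx hy hz; rewrite hx hy hz; case: (s l) => -[] ? ? ?; rewrite eqxx.
Qed.

(** The sum of the constituents in [S], extended by zero to all variables of the power. *)
Definition indexed_by (S : {set annot (ptensor_pow T N)}) :
    tensor F {ffun 'I_N -> 'I_q.+2} {ffun 'I_N -> 'I_q.+2} {ffun 'I_N -> 'I_q.+2} :=
  fun x y z => if (pN x, pN y, pN z) \in S then tN x y z else 0.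

(** Under the constant pattern [zero_pos pi] is a copy of ['I_N], and along this identification
    [merged] becomes the whole sum of the constituents. *)
Lemma merged_volumeP S pi v : (forall l, pi l = None) ->
  has_volume (merged S pi) v <->
  mm_on (indexed_by S) (preim pN (fun i => [exists s in S, s.1.1 == i]))
    (preim pN (fun i => [exists s in S, s.1.2 == i]))
    (preim pN (fun i => [exists s in S, s.2 == i])) v.
Proof.
move=> pi0.
have h l : pi l == None by rewrite pi0.
pose inj l : zero_pos pi := exist _ l (h l).
have valK l : val (inj l) = l by [].
have injK l : inj (val l) = l by apply: val_inj.
pose phi (x : {ffun 'I_N -> 'I_q.+2}) : {ffun zero_pos pi -> 'I_q.+2} := [ffun l => x (val l)].
pose psi (x : {ffun zero_pos pi -> 'I_q.+2}) : {ffun 'I_N -> 'I_q.+2} := [ffun l => x (inj l)].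
have phiK : cancel phi psi by move=> x; apply/ffunP => l; rewrite !ffunE.
have psiK : cancel psi phi by move=> x; apply/ffunP => l; rewrite !ffunE injK.
have blockE (c : annot T -> 'I_3) (k : annot (ptensor_pow T N) -> {ffun 'I_N -> 'I_3}) x :
    (forall s l, c (annot_at s l) = k s l) ->
    (phi x \in \bigcup_(s in S) [set x : {ffun zero_pos pi -> xvar T} |
       [forall l, x l \in [set u | p u == c (annot_at s (\val l))]]]) =
    [exists s in S, k s == pN x].
  move=> hc; apply/bigcupP/existsP => -[s].
    move=> sS; rewrite inE => /forallP e; exists s; rewrite sS /=; apply/eqP/ffunP => l.
    by have := e (inj l); rewrite inE !ffunE /= hc => /eqP.
  move=> /andP[sS /eqP e]; exists s => //; rewrite inE; apply/forallP => l.
  by rewrite inE ffunE hc e ffunE.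
have tE x y z :
   \sum_(s in S) tensor_family
           (fun l : zero_pos pi => constituent0 (annot_at s (\val l))) (phi x) (phi y) (phi z) =
   indexed_by S x y z.
  rewrite /indexed_by.
  have tp : tensor_family (fun _ => t) (phi x) (phi y) (phi z) = tN x y z.
    rewrite /tensor_family (reindex inj) /=; last first.
      by exists val => l _; rewrite ?injK.
    by apply: eq_bigr => l _; rewrite !ffunE.
  have cE (s : annot (ptensor_pow T N)) :
      [forall l, annot_at s (\val l) == (p (phi x l), p (phi y l), p (phi z l))] =
      (s == (pN x, pN y, pN z)).
    apply/forallP/eqP => [e|-> l]; last by rewrite /annot_at !ffunE.
    case: s e => -[s1 s2] s3 e; congr (_, _, _); apply/ffunP => l;
    by have /eqP [] := e (inj l); rewrite !ffunE.
  under eq_bigr => s _ do rewrite merged_termE tp cE.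
  rewrite -big_mkcondr /=; case: ifP => hs.
    rewrite (big_pred1 (pN x, pN y, pN z)) // => s /=.
    by case: eqP => [->|]; rewrite ?andbT ?andbF.
  by rewrite big1 // => s /andP[sS /eqP e]; rewrite e hs in sS.
split.
  move/has_volumeP; apply: (mm_on_iso psi); first by exists phi.
  - by move=> x y z _ _ _; rewrite -tE !psiK.
  - by move=> x; rewrite /= -(blockE (fun s => s.1.1) (fun s => s.1.1)) // psiK.
  - by move=> x; rewrite /= -(blockE (fun s => s.1.2) (fun s => s.1.2)) // psiK.
  - by move=> x; rewrite /= -(blockE (fun s => s.2) (fun s => s.2)) // psiK.
move=> m; apply/has_volumeP; move: m; apply: (mm_on_iso phi); first by exists psi.
- by move=> x y z _ _ _; rewrite -tE.
- by move=> x; rewrite /= -(blockE (fun s => s.1.1) (fun s => s.1.1)).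
- by move=> x; rewrite /= -(blockE (fun s => s.1.2) (fun s => s.1.2)).
- by move=> x; rewrite /= -(blockE (fun s => s.2) (fun s => s.2)).
Qed.

End Power.
End CWMerging.

Section CWMergingValue.
Context {R : realType} {rho : R} {F : fieldType} {q : nat}.
Local Notation T := (cw R F q).
Local Notation p := (@cw_part q).
Local Notation t := (@cw_coef F q).
Variable N : nat.
Local Notation tN := (tensor_family (fun _ : 'I_N => t)).
Local Notation pN := (ffun_part 'I_N p).
Local Notation indices k S := (fun i => [exists s in S, k s == i]).
Implicit Types (S : {set annot (ptensor_pow T N)}) (pi : mpattern T N).

Lemma cw_supp_elim {A : kept (ptensor_pow T N)} {s : annot (ptensor_pow T N)} :
  s \in supp (prestrict A) ->
  (exists x y z, [/\ pN x = s.1.1, pN y = s.1.2, pN z = s.2 & tN x y z != 0]) /\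
  [/\ s.1.1 \in A.1.1, s.1.2 \in A.1.2 & s.2 \in A.2].
Proof.
by move/(@supp_prestrictP F (ptensor_pow T N)) => [/(@suppP F (ptensor_pow T N))].
Qed.

Lemma cw_supp_intro (A : kept (ptensor_pow T N)) x y z :
  tN x y z != 0 -> pN x \in A.1.1 -> pN y \in A.1.2 -> pN z \in A.2 ->
  (pN x, pN y, pN z) \in supp (prestrict A).
Proof.
move=> n Ax Ay Az; apply/(@supp_prestrictP F (ptensor_pow T N)); split=> //.
by apply/(@suppP F (ptensor_pow T N)); exists x, y, z.
Qed.

Lemma cw_supp_sub {A : kept (ptensor_pow T N)} {s : annot (ptensor_pow T N)} :
  s \in supp (prestrict A) -> s \in supp (ptensor_pow T N).
Proof. by move/(@supp_prestrictP F (ptensor_pow T N)) => []. Qed.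

Lemma merged_valueE S v :
  [exists pi : mpattern T N, common_pattern S pi] ->
  mm_on (indexed_by N S) (preim pN (indices (fun s => s.1.1) S))
    (preim pN (indices (fun s => s.1.2) S)) (preim pN (indices (fun s => s.2) S)) v ->
  merged_value (T := T) rho S = v%:R `^ (rho / 3).
Proof.
move=> /existsP [pi0 cp0] m; rewrite /merged_value; case: pickP => [pi cp|/(_ pi0)]; last by rewrite cp0.
have piN := cw_patternP N S pi cp.
rewrite [X in _ * X]big1 ?mulr1; last by move=> l _; rewrite piN.
congr (_%:R `^ _); apply: xget_unique; first by apply/merged_volumeP.
by move=> u /= /merged_volumeP -/(_ piN) /mm_on_unique/(_ m).
Qed.

Lemma common_pattern_supp S : {subset S <= supp (ptensor_pow T N)} ->
  common_pattern S [ffun => None].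
Proof.
move=> SS; apply/andP; split; first by apply/forallP => l; rewrite ffunE.
apply/forallP => s; apply/implyP => sS; apply/forallP => l; rewrite ffunE.
have sl := supp_powP N s l (SS s sS).
by rewrite inE sl; apply/asboolP/cw_supp_mm.
Qed.

(** Keep the parts that some class uses and group the surviving constituents by class: without cross
    terms, each of them belongs to exactly one class. *)
Lemma Vm_pow_ge r : cw_achieves (rho := rho) (F := F) (q := q) 'I_N r -> r <= Vm_pow T rho N.
Proof.
case=> -[C ax ay az v] [/= _ nc mm rle].
pose A : kept (ptensor_pow T N) :=
  ([set i | [exists c, ax c i]], [set i | [exists c, ay c i]], [set i | [exists c, az c i]]).
pose SS c : {set annot (ptensor_pow T N)} :=
  [set s in supp (prestrict A) | [&& ax c s.1.1, ay c s.1.2 & az c s.2]].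
have inSS c x y z : tN x y z != 0 -> ax c (pN x) -> ay c (pN y) -> az c (pN z) ->
    (pN x, pN y, pN z) \in SS c.
  move=> n hx hy hz; rewrite inE /= hx hy hz !andbT.
  by apply: cw_supp_intro => //; rewrite inE; apply/existsP; exists c.
have suppSS s : s \in supp (prestrict A) -> exists c, s \in SS c.
  move=> sA; have [[x [y [z [hx hy hz n]]]]] := cw_supp_elim sA.
  move=> -[]; rewrite !inE => /existsP[c cx] /existsP[c' cy] /existsP[c'' cz].
  have [|||] := nc x y z c c' c'' n; rewrite ?hx ?hy ?hz // => e e'; subst c' c''.
  by exists c; rewrite inE sA cx cy cz.
have disSS s c c' : s \in SS c -> s \in SS c' -> c = c'.
  rewrite inE => /andP[h /and3P[cx cy cz]]; have [[x [y [z [hx hy hz n]]]] _] := cw_supp_elim h.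
  rewrite inE => /andP[_ /and3P[cx' cy' cz']].
  by have [|||] := nc x y z c c' c' n; rewrite ?hx ?hy ?hz.
(* Nonemptiness makes [SS] injective and keeps the empty set out of the partition. *)
have neSS c : exists s, s \in SS c.
  by have [x [y [z [hx hy hz n]]]] := mm_on_ex (mm c); exists (pN x, pN y, pN z); apply: inSS.
have injSS : injective SS.
  by move=> c c' e; have [s sS] := neSS c; apply: (disSS s) => //; rewrite -e.
pose P := [set SS c | c : C].
have mmSS c : mm_on (indexed_by N (SS c)) (preim pN (indices (fun s => s.1.1) (SS c)))
    (preim pN (indices (fun s => s.1.2) (SS c))) (preim pN (indices (fun s => s.2) (SS c))) (v c).
  apply: mm_on_eq (mm c).
  - move=> x y z hx hy hz; rewrite /indexed_by; case: ifPn => // h.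
    by apply/eqP; apply: contraNT h => n; apply: inSS.
  - move=> x /=; apply/idP/existsP => [hx|[s /andP[]]].
      have [y [z [hy hz n]]] := mm_on_x x (mm c) hx.
      by exists (pN x, pN y, pN z); rewrite inSS /=.
    by rewrite inE => /andP[_ /and3P[? _ _]] /eqP <-.
  - move=> y /=; apply/idP/existsP => [hy|[s /andP[]]].
      have [x [z [hx hz n]]] := mm_on_y y (mm c) hy.
      by exists (pN x, pN y, pN z); rewrite inSS /=.
    by rewrite inE => /andP[_ /and3P[_ ? _]] /eqP <-.
  - move=> z /=; apply/idP/existsP => [hz|[s /andP[]]].
      have [x [y [hx hy n]]] := mm_on_z z (mm c) hz.
      by exists (pN x, pN y, pN z); rewrite inSS /=.
    by rewrite inE => /andP[_ /and3P[_ _ ?]] /eqP <-.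
have sub c : {subset SS c <= supp (ptensor_pow T N)}.
  by move=> s; rewrite inE => /andP[/cw_supp_sub].
have disj c c' (bx : C -> pred _) (k : annot (ptensor_pow T N) -> {ffun 'I_N -> 'I_3}) :
    (forall s d, s \in SS d -> bx d (k s)) ->
    (forall x, bx c (pN x) -> bx c' (pN x) -> c = c') -> SS c != SS c' ->
    [disjoint \bigcup_(s in SS c) [set x : {ffun 'I_N -> 'I_q.+2} | pN x == k s] &
              \bigcup_(s in SS c') [set x : {ffun 'I_N -> 'I_q.+2} | pN x == k s]].
  move=> hk hb ne; apply/pred0P => x /=; apply/negP => /andP[/bigcupP [s sS]].
  rewrite inE => /eqP e /bigcupP [s' sS']; rewrite inE => /eqP e'.
  by case/eqP: ne; congr SS; apply: (hb x); [rewrite e; apply: hk|rewrite e'; apply: hk].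
have cr : consistent_restriction A P.
  split.
  - rewrite /finset.partition; apply/and3P; split.
    + apply/eqP/setP => s; apply/bigcupP/idP => [[_ /imsetP [c _ ->]]|/suppSS [c sc]].
        by rewrite inE => /andP[].
      by exists (SS c) => //; apply: imset_f.
    + apply/finset.trivIsetP => _ _ /imsetP [c _ ->] /imsetP [c' _ ->] ne.
      apply/pred0P => s /=; apply/negP => /andP[sc sc'].
      by case/eqP: ne; rewrite (disSS s c c').
    + apply/negP => /imsetP [c _ e]; have [s] := neSS c.
      by rewrite -e inE.
  - move=> _ /imsetP [c _ ->]; exists [ffun => None]; first exact: common_pattern_supp.
    by exists (v c); apply/merged_volumeP => // l; rewrite ffunE.
  (* A variable shared by the classes [c] and [c'] completes, inside [c], to a nonzero coefficient.
     With that variable counted in [c'] this is a cross term, so [nc] forces [c = c']. *)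
  - move=> _ _ /imsetP [c _ ->] /imsetP [c' _ ->] ne; split.
    + apply: (disj c c' ax (fun s => s.1.1)) ne; first by move=> s d; rewrite inE => /andP[_ /and3P[]].
      move=> x hc hc'; have [y [z [hy hz n]]] := mm_on_x x (mm c) hc.
      by have [-> _] := nc _ _ _ _ _ _ n hc' hy hz.
    + apply: (disj c c' ay (fun s => s.1.2)) ne; first by move=> s d; rewrite inE => /andP[_ /and3P[]].
      move=> y hc hc'; have [x [z [hx hz n]]] := mm_on_y y (mm c) hc.
      by have [-> _] := nc _ _ _ _ _ _ n hx hc' hz.
    + apply: (disj c c' az (fun s => s.2)) ne; first by move=> s d; rewrite inE => /andP[_ /and3P[]].
      move=> z hc hc'; have [x [y [hx hy n]]] := mm_on_z z (mm c) hc.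
      by have [_ ->] := nc _ _ _ _ _ _ n hx hy hc'.
apply: le_trans rle _.
have -> : \sum_c (v c)%:R `^ (rho / 3) = \sum_(S in P) merged_value (T := T) rho S.
  rewrite big_imset /=; last by move=> ? ? _ _; apply: injSS.
  apply: eq_bigr => c _; rewrite (merged_valueE _ (v c)) //.
  by apply/existsP; exists [ffun => None]; apply: common_pattern_supp.
rewrite /Vm_pow; apply: (bigmax_sup (A, P)); [exact/asboolP|exact: lexx].
Qed.

(** The converse of [Vm_pow_ge]: the classes of a consistent restriction have disjoint variables,
    which excludes cross terms. The default 0 of the maximum is achieved by no class at all. *)
Lemma Vm_pow_achieves : cw_achieves (rho := rho) (F := F) (q := q) 'I_N (Vm_pow T rho N).
Proof.
rewrite /Vm_pow; apply: big_ind.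
- exact: achieves0.
- by move=> x y hx hy; rewrite /Num.max; case: ifP.
move=> [A P] /= /asboolP [/and3P[/eqP cov /finset.trivIsetP triv ne0] cons disj].
have subA S s : S \in P -> s \in S -> s \in supp (prestrict A).
  by move=> SP sS; rewrite -cov; apply/bigcupP; exists S.
have sub S : S \in P -> {subset S <= supp (ptensor_pow T N)}.
  by move=> SP s /(subA _ _ SP) /cw_supp_sub.
pose C := {S in P}.
have annE x y z (S S' S'' : C) : tN x y z != 0 -> indices (fun s => s.1.1) (val S) (pN x) ->
    indices (fun s => s.1.2) (val S') (pN y) -> indices (fun s => s.2) (val S'') (pN z) ->
    [/\ (pN x, pN y, pN z) \in val S, S = S' & S = S''].
  move=> n /existsP [s /andP[sS /eqP ex]] /existsP [s' /andP[sS' /eqP ey]] /existsP [s'' /andP[sS'' /eqP ez]].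
  have : (pN x, pN y, pN z) \in supp (prestrict A).
    have [_ [? _ _]] := cw_supp_elim (subA _ _ (valP S) sS).
    have [_ [_ ? _]] := cw_supp_elim (subA _ _ (valP S') sS').
    have [_ [_ _ ?]] := cw_supp_elim (subA _ _ (valP S'') sS'').
    by apply: cw_supp_intro; rewrite // -?ex -?ey -?ez.
  rewrite -cov => /bigcupP [S0 S0P h0].
  (* The constituent at [x], [y], [z] lies in the class [S0]; any class with a constituent sharing
     one of its indices shares variables with [S0], so it equals [S0]. *)
  have SE (S1 : C) s1 : s1 \in val S1 ->
     [\/ s1.1.1 = pN x, s1.1.2 = pN y | s1.2 = pN z] -> val S1 = S0.
    move=> h1 e1; apply/eqP; apply/negPn/negP => ne.
    have [dx dy dz] := disj _ _ (valP S1) S0P ne.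
    case: e1 => e1.
    - move/pred0P: dx => /(_ x) /negP; apply; apply/andP; split; apply/bigcupP.
        by exists s1 => //; rewrite inE /= e1.
      by exists (pN x, pN y, pN z); rewrite ?inE /=.
    - move/pred0P: dy => /(_ y) /negP; apply; apply/andP; split; apply/bigcupP.
        by exists s1 => //; rewrite inE /= e1.
      by exists (pN x, pN y, pN z); rewrite ?inE /=.
    - move/pred0P: dz => /(_ z) /negP; apply; apply/andP; split; apply/bigcupP.
        by exists s1 => //; rewrite inE /= e1.
      by exists (pN x, pN y, pN z); rewrite ?inE /=.
  have e0 := SE S s sS (Or31 _ _ ex); have e1 := SE S' s' sS' (Or32 _ _ ey).
  have e2 := SE S'' s'' sS'' (Or33 _ _ ez).
  by split; [rewrite e0|apply: val_inj; rewrite e0 e1|apply: val_inj; rewrite e0 e2].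
have mmS (S : C) : exists v, mm_on (indexed_by N (val S)) (preim pN (indices (fun s => s.1.1) (val S)))
    (preim pN (indices (fun s => s.1.2) (val S))) (preim pN (indices (fun s => s.2) (val S))) v.
  have [pi cp [v hv]] := cons _ (valP S); exists v.
  by apply/(merged_volumeP _ _ pi) => //; apply: cw_patternP cp.
have [v hv] := choice mmS.
exists (Blocks C (fun S : C => indices (fun s => s.1.1) (val S)) (fun S : C => indices (fun s => s.1.2) (val S))
   (fun S : C => indices (fun s => s.2) (val S)) v); split=> //=.
- by move=> x y z S S' S'' n hx hy hz; have [] := annE _ _ _ _ _ _ n hx hy hz.
- move=> S; apply: mm_on_eq (hv S) => // x y z hx hy hz; rewrite /indexed_by; case: ifPn => // h.
  apply/esym/eqP; apply: contraNT h => n.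
  by have [] := annE _ _ _ _ _ _ n hx hy hz.
- rewrite big_sub; apply: ler_sum => /= S _; rewrite (merged_valueE _ (v S)); first exact: lexx.
    by apply/existsP; exists [ffun => None]; apply/common_pattern_supp/sub/(valP S).
  exact: (hv S).
Qed.

End CWMergingValue.

(** * Supermultiplicativity *)

Lemma achieves_sub {R : realType} {rho : R} {F : fieldType} {X I : finType}
    {p : X -> I} {t : tensor F X X X} {PX PY PZ : pred I} (PX' PY' PZ' : pred I) r :
  subpred PX PX' -> subpred PY PY' -> subpred PZ PZ' ->
  achieves rho p t PX PY PZ r -> achieves rho p t PX' PY' PZ' r.
Proof.
move=> hx hy hz [b [h1 h2 h3 h4]]; exists b; split=> // c; have [sx sy sz] := h1 c.
by split=> i; [move/sx/hx|move/sy/hy|move/sz/hz].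
Qed.

(** Each class owns an [x]-variable, so there are at most |X| classes; each volume satisfies nmp <=
    nm * mp <= |X|^2, and the exponent rho/3 is at most 1. This is the growth bound needed for
    convergence. *)
Lemma achieves_bound {R : realType} {rho : R} {F : fieldType} {X I : finType}
    {p : X -> I} {t : tensor F X X X} {PX PY PZ : pred I} r :
  rho <= 3 -> achieves rho p t PX PY PZ r -> r <= (#|X| ^ 3)%:R.
Proof.
move=> rho3 [[C ax ay az v] [/= _ nc mm rle]]; apply: (le_trans rle).
have xc c : {x | ax c (p x)}.
  by apply: cid; have [x [y [z [hx _ _ _]]]] := mm_on_ex (mm c); exists x.
have xci : injective (fun c => sval (xc c)).
  move=> c c' e; have hx := svalP (xc c); have hx' := svalP (xc c'); rewrite -e in hx'.
  by have [y [z [hy hz n]]] := mm_on_x _ (mm c) hx; have [->] := nc _ _ _ _ _ _ n hx' hy hz.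
have vle c : (v c <= #|X| ^ 2)%N.
  have [[A B D f g h] [/= [v0 ve]] [fi gi hi] _ _] := mm c.
  have := leq_card f fi; have := leq_card g gi; rewrite !card_prod.
  move: v0; rewrite ve !muln_gt0 => /andP[/andP[a0 b0] d0].
  by move: #|A| #|B| #|D| a0 b0 d0 => a b d a0 b0 d0 h2 h1; rewrite -mulnn leq_mul //; apply: leq_trans h2; exact: leq_pmull.
apply: (@le_trans _ _ (\sum_(c : C) (#|X| ^ 2)%:R)).
  apply: ler_sum => c _; apply: (@le_trans _ _ (v c)%:R); last by rewrite ler_nat.
  rewrite -[leRHS]powRr1 // ler_powR //; first by rewrite ler1n (mm_on_gt0 (mm c)).
  by rewrite ler_pdivrMr // mul1r.
rewrite sumr_const -[leLHS]mulr_natl -natrM ler_nat [leqRHS]expnS leq_mul //.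
exact: leq_card xci.
Qed.

(** Fekete's lemma for superadditive sequences. The limit is the supremum of [a n / n], which also
    gives the bound on every single term. *)
Lemma fekete {R : realType} (a : nat -> R) (k : R) :
  (forall n, 0 <= a n) -> (forall n m, a n + a m <= a (n + m)%N) ->
  (forall n, a n <= n%:R * k) ->
  exists l : R, ((fun n => a n / n%:R) @ \oo --> l)%classic /\ (forall n, (0 < n)%N -> a n <= n%:R * l).
Proof.
move=> a0 aD ak; pose S := [set a n / n%:R | n in [set n | (0 < n)%N]]%classic.
have ubS : has_sup S.
  split; first by exists (a 1%N / 1%:R), 1%N.
  by exists k => _ [n /= n0 <-]; rewrite ler_pdivrMr ?ltr0n // mulrC.
have supS n : (0 < n)%N -> a n / n%:R <= sup S.
  by move=> n0; apply: ub_le_sup; [case: ubS|exists n].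
exists (sup S); split; last first.
  by move=> n n0; rewrite mulrC -ler_pdivrMr ?ltr0n // supS.
have am j m : j%:R * a m <= a (j * m)%N.
  elim: j => [|j IH]; first by rewrite mul0r.
  rewrite mulSn -natr1 mulrDl mul1r addrC; apply: le_trans (aD _ _).
  by rewrite lerD2l.
apply/cvgrPdist_le => /= e e0.
have e20 : 0 < e / 2 by rewrite divr_gt0.
have [_ [m /= m0 <-] hm] := sup_adherent e20 ubS.
have m0' : 0 < m%:R :> R by rewrite ltr0n.
near=> n.
have n0 : (0 < n)%N by near: n; exists 1%N.
have n0' : 0 < n%:R :> R by rewrite ltr0n.
have nbig : a m / (e / 2) <= n%:R.
  by near: n; exact: nbhs_infty_ger.
rewrite ger0_norm ?subr_ge0 ?supS // lerBlDr.
(* Dividing [n] by [m], the remainder contributes a nonnegative term that is dropped; the loss is at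
   most [a m], negligible against [n]. *)
have h1 : (n %/ m)%:R * a m <= a n.
  apply: le_trans (am _ _) _; rewrite {2}(divn_eq n m).
  by apply: le_trans (aD _ _); rewrite lerDl.
have h2 : n%:R <= (n %/ m)%:R * m%:R + m%:R :> R.
  by rewrite -natrM -natrD ler_nat {1}(divn_eq n m) leq_add2l ltnW // ltn_mod.
have h3 : n%:R * (a m / m%:R) - a m <= a n.
  apply: le_trans h1; rewrite lerBlDr mulrA ler_pdivrMr //.
  rewrite mulrDl -mulrA [a m * _]mulrC mulrA -mulrDl.
  exact: ler_wpM2r.
have h4 : a m / m%:R <= a n / n%:R + a m / n%:R.
  by rewrite -mulrDl ler_pdivlMr // mulrC -lerBlDr.
have h5 : a m / n%:R <= e / 2.
  by rewrite ler_pdivrMr // mulrC -ler_pdivrMr.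
lra.
Unshelve. all: by end_near.
Qed.

(** * Convergence of the merging values of the powers *)

Section CWLimit.
Context {R : realType} {rho : R} {F : fieldType} {q : nat}.
Hypotheses (rho0 : 0 <= rho) (rho3 : rho <= 3).
Local Notation T := (cw R F q).
Local Notation p := (@cw_part q).
Local Notation t := (@cw_coef F q).
Local Notation achieves := (cw_achieves (rho := rho) (F := F) (q := q)).

Lemma cw_achievesE D r :
  achieves D r <-> family_achieves rho p t D (fun _ => xpredT) (fun _ => xpredT) (fun _ => xpredT) r.
Proof. by split; apply: achieves_sub => // i _; apply/forallP. Qed.

Lemma cw_achieves_card (D D' : finType) r : #|D| = #|D'| -> achieves D r -> achieves D' r.
Proof.
move=> e /cw_achievesE h; apply/cw_achievesE; move: h.
apply: (family_achieves_iso (fun d => enum_val (cast_ord e (enum_rank d)))) => //.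
exists (fun d => enum_val (cast_ord (esym e) (enum_rank d))) => d.
  by rewrite enum_valK cast_ordK enum_rankK.
by rewrite enum_valK cast_ordKV enum_rankK.
Qed.

Lemma cw_achieves_sum (D D' : finType) r r' : 0 <= r -> 0 <= r' ->
  achieves D r -> achieves D' r' -> achieves (D + D')%type (r * r').
Proof.
move=> r0 r0' /cw_achievesE h /cw_achievesE h'; apply/cw_achievesE.
exact: family_achieves_sum.
Qed.

(** Take the constituent (0,0,2) in every factor: its volume is positive. This makes the logarithms
    of the merging values nonnegative. *)
Lemma cw_achieves1 (D : finType) : achieves D 1.
Proof.
pose e : 'I_q.+2 := ord_max.
have [v mm] : cw_mm_at F q ord0 ord0 e by apply: cw_mm_at_002.
have h : forall d : D, mm_on t (preim p (pred1 (p ord0))) (preim p (pred1 (p ord0)))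
    (preim p (pred1 (p e))) v by [].
have := family_achieves_mm (rho := rho) _ _ _ _ h.
move=> /(achieves_sub xpredT xpredT xpredT) => /(_ (fun _ _ => isT) (fun _ _ => isT) (fun _ _ => isT)).
apply: achieves_le; rewrite big_const iter_mulr mulr1.
apply: exprn_ege1; rewrite -[leLHS](powRr0 v%:R) ler_powR ?ler1n ?(mm_on_gt0 mm) //.
by rewrite divr_ge0.
Qed.

Lemma Vm_pow_ge1 N : 1 <= Vm_pow T rho N.
Proof. exact/Vm_pow_ge/cw_achieves1. Qed.

Lemma Vm_pow_super N M : Vm_pow T rho N * Vm_pow T rho M <= Vm_pow T rho (N + M).
Proof.
apply: Vm_pow_ge; apply: (@cw_achieves_card ('I_N + 'I_M)%type); first by rewrite card_sum !card_ord.
have ge0 K : 0 <= Vm_pow T rho K by apply: le_trans (Vm_pow_ge1 K).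
by apply: cw_achieves_sum => //; apply: Vm_pow_achieves.
Qed.

Lemma Vm_pow_bound N : Vm_pow T rho N <= ((q.+2 ^ 3) ^ N)%:R.
Proof.
apply: le_trans (achieves_bound _ rho3 (Vm_pow_achieves N)) _.
by rewrite card_ffun !card_ord -!expnM mulnC.
Qed.

(** Fekete's lemma is applied to the logarithm of [Vm_pow]; it also shows that the limit defining
    [Vm] exists. *)
Lemma Vm_ge N : (0 < N)%N -> Vm_pow T rho N <= Vm T rho ^+ N.
Proof.
move=> N0; pose u n := Vm_pow T rho n.
have u0 n : 0 < u n by apply: lt_le_trans (Vm_pow_ge1 n).
have [l [cv hl]] : exists l : R, ((fun n => ln (u n) / n%:R) @ \oo --> l)%classic /\ (
    forall n, (0 < n)%N -> ln (u n) <= n%:R * l).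
  apply: (@fekete _ (fun n => ln (u n)) (ln (q.+2 ^ 3)%:R)).
  - by move=> n; rewrite ln_ge0 ?Vm_pow_ge1.
  - move=> n m; rewrite -lnM ?posrE // ler_ln ?posrE ?mulr_gt0 //; exact: Vm_pow_super.
  - move=> n; rewrite mulr_natl -lnXn ?ltr0n ?expn_gt0 // ler_ln ?posrE ?exprn_gt0 ?ltr0n ?expn_gt0 //.
    by rewrite -natrX Vm_pow_bound.
have -> : Vm T rho = expR l.
  rewrite /Vm; apply: cvg_lim => //.
  have -> : (fun n => Vm_pow T rho n `^ n%:R^-1) = (fun n => expR (ln (u n) / n%:R)).
    by apply/funext => n; rewrite /powR gt_eqF ?u0 // mulrC.
  by apply: continuous_cvg => //; apply: continuous_expR.
rewrite -expRM_natl -[leLHS]lnK ?posrE ?u0 // ler_expR.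
exact: hl.
Qed.

Lemma Vm_ge1 : 1 <= Vm T rho.
Proof. by rewrite -[leRHS]expr1; apply: le_trans (Vm_ge 1 isT); apply: Vm_pow_ge1. Qed.

End CWLimit.

(** * Repartitionings of the square *)

(** Reading [n] modulo 3 lets the axes following axis [n] be written [n.+1] and [n.+2] without
    wrapping around. *)
Definition rot3 {A : Type} (a b c : A) (n : nat) : A :=
  match (n %% 3)%N with 0%N => a | 1%N => b | _ => c end.

Lemma rot3_mod {A : Type} (a b c : A) n : rot3 a b c (n %% 3) = rot3 a b c n.
Proof. by rewrite /rot3 modn_mod. Qed.

Lemma rot3_period {A : Type} (a b c : A) n : rot3 a b c n.+3 = rot3 a b c n.
Proof. by rewrite -addn3 /rot3 modnDr. Qed.

Lemma rot3P {A B : Type} (a b c : A) (a' b' c' : B) (P : A -> B -> Prop) n :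
  P a a' -> P b b' -> P c c' -> P (rot3 a b c n) (rot3 a' b' c' n).
Proof. by rewrite /rot3; case: (n %% 3)%N => [|[|?]]. Qed.

Lemma mm_on_rot3 {F : fieldType} {X : finType} {t : tensor F X X X}
    (tC : forall x y z, t x y z = t y z x) (P Q S : pred X) v n :
  mm_on t P Q S v ->
  mm_on t (rot3 P Q S n) (rot3 P Q S n.+1) (rot3 P Q S n.+2) v.
Proof.
move=> m; elim: n => // n IH; rewrite rot3_period; exact: mm_on_cyclic.
Qed.

Section Squared.
Context {R : realType} {rho : R} {F : fieldType} {q : nat}.
Hypotheses (rho0 : 0 <= rho) (rho3 : rho <= 3).
Local Notation T := (cw R F q).
Local Notation B := (etensor_prod T T).
Local Notation X2 := ('I_q.+2 * 'I_q.+2)%type.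
Local Notation I2 := ('I_3 * 'I_3)%type.

Definition cw2_part (x : X2) : I2 := (cw_part x.1, cw_part x.2).
Definition cw2_coef : tensor F X2 X2 X2 :=
  fun x y z => cw_coef F x.1 y.1 z.1 * cw_coef F x.2 y.2 z.2.
Local Notation p2 := cw2_part.
Local Notation t2 := cw2_coef.

Lemma cw2_coef_cyclic x y z : t2 x y z = t2 y z x.
Proof. by rewrite /cw2_coef cw_coef_cyclic [X in _ * X]cw_coef_cyclic. Qed.

Lemma cw_est (x y z : 'I_q.+2) v :
  mm_on (@cw_coef F q) (fun x' => cw_part x' == cw_part x)
    (fun y' => cw_part y' == cw_part y) (fun z' => cw_part z' == cw_part z) v ->
  @est R F T rho (cw_part x, cw_part y, cw_part z) = v%:R `^ (rho / 3).
Proof.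
move=> m; congr (_%:R `^ _); apply: mm_on_volume.
by apply: mm_on_eq m => // u; rewrite /= inE.
Qed.

(** Volumes multiply under products, so the multiplicative estimates on the square of [T_cw] are
    given by actual volumes. *)
Lemma cw2_mm x y z : t2 x y z != 0 ->
  exists v, mm_on t2 (preim p2 (pred1 (p2 x))) (preim p2 (pred1 (p2 y)))
     (preim p2 (pred1 (p2 z))) v /\
   @est R F B rho (p2 x, p2 y, p2 z) = v%:R `^ (rho / 3).
Proof.
rewrite mulf_eq0 negb_or => /andP[/cw_mm [v m] /cw_mm [v' m']].
exists (v * v')%N; split.
  by have := mm_on_prod _ _ _ _ _ _ _ _ _ _ m m'; apply: mm_on_eq.
by rewrite natrM powRM // -(cw_est _ _ _ _ m) -(cw_est _ _ _ _ m').
Qed.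

Context {I J K : finType}.
Variables (fx : I2 -> I) (fy : I2 -> J) (fz : I2 -> K).
Local Notation TT := (@repartition R F T T I J K fx fy fz).

(* The axes are numbered modulo 3; axis [0] of the [r]-fold rotation of a block is
   axis [r] of the block. *)
Definition in_axis (b : I * J * K) (n : nat) (u : I2) : bool :=
  rot3 (fx u == b.1.1) (fy u == b.1.2) (fz u == b.2) n.

Lemma in_axisE b n :
  in_axis b n =1 rot3 (fun u => fx u == b.1.1) (fun u => fy u == b.1.2) (fun u => fz u == b.2) n.
Proof. by move=> u; rewrite /in_axis; apply: (rot3P _ _ _ _ _ _ (fun (c : bool) (k : pred I2) => c = k u)). Qed.

Lemma in_axis_mod b n : in_axis b (n %% 3) =1 in_axis b n.
Proof. by move=> u; rewrite /in_axis rot3_mod. Qed.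

(** Concerns the n-th power of [b * brot * brot2], realized inside [3 n] unrotated factors by cyclic
    invariance: the position [(l, r)] holds [b] rotated [r] times. *)
Definition block_achieves (b : I * J * K) (n : nat) (r : R) : Prop :=
  family_achieves rho p2 t2 ('I_n * 'I_3)%type (fun d => in_axis b d.2)
    (fun d => in_axis b d.2.+1) (fun d => in_axis b d.2.+2) r.

Lemma family_mm_rot3 n (P Q S : pred I2) v :
  mm_on t2 (preim p2 P) (preim p2 Q) (preim p2 S) v ->
  family_achieves rho p2 t2 ('I_n * 'I_3)%type (fun d => rot3 P Q S d.2)
    (fun d => rot3 P Q S d.2.+1) (fun d => rot3 P Q S d.2.+2)
    ((v%:R `^ (rho / 3)) ^+ (3 * n)).
Proof.
move=> m; have h (d : 'I_n * 'I_3) :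
    mm_on t2 (preim p2 (rot3 P Q S d.2)) (preim p2 (rot3 P Q S d.2.+1)) (preim p2 (rot3 P Q S d.2.+2)) v.
  move/(mm_on_rot3 cw2_coef_cyclic _ _ _ _ d.2): m.
  by apply: mm_on_eq => // x; apply: (rot3P _ _ _ _ _ _ (fun k k' => k x = preim p2 k' x)).
have := family_achieves_mm (rho := rho) _ _ _ _ h.
by rewrite prodr_const card_prod !card_ord mulnC.
Qed.

(** The case in which merging gains: the whole power is one class, however many constituents the
    block has. *)
Lemma block_achieves_mm (b : annot TT) n : is_matmul (constituent b) ->
  block_achieves b n (((volume (constituent b))%:R `^ (rho / 3)) ^+ (3 * n)).
Proof.
rewrite /constituent => h; have := is_matmulP _ _ _ _ h.
move: (volume _) => v m.
have {}m : mm_on t2 (preim p2 (fun u => fx u == b.1.1)) (preim p2 (fun u => fy u == b.1.2))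
    (preim p2 (fun u => fz u == b.2)) v.
  by apply: mm_on_eq m => // x; rewrite /= inE.
have := family_mm_rot3 n _ _ _ _ m; apply: achieves_sub => i /forallP hi;
by apply/forallP => d; rewrite in_axisE.
Qed.

(** A fallback for small [n] and for blocks of value 0: a single constituent of the block, repeated
    in all positions. *)
Lemma block_achieves1 (b : annot TT) n : b \in supp TT -> block_achieves b n 1.
Proof.
move=> /(@suppP F TT) [x [y [z [/= hx hy hz n0]]]].
have [v [m _]] := cw2_mm x y z n0.
have h1 : 1 <= (v%:R `^ (rho / 3)) ^+ (3 * n) :> R.
  apply: exprn_ege1; rewrite -[leLHS](powRr0 v%:R) ler_powR ?ler1n ?(mm_on_gt0 m) //.
  by rewrite divr_ge0.
have := achieves_le _ 1 h1 (family_mm_rot3 n _ _ _ v m).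
apply: achieves_sub => i /forallP hi; apply/forallP => d; move: (hi d); rewrite in_axisE;
by apply: (rot3P _ _ _ _ _ _ (fun k k' : pred I2 => k (i d) -> k' (i d))) => /eqP->; apply/eqP.
Qed.

End Squared.

Lemma family_achieves_union {R : realType} {rho : R} {F : fieldType} {X I C D : finType}
    {p : X -> I} {t : tensor F X X X} (ax ay az : C -> D -> pred I)
    (qx qy qz : D -> pred I) (r : C -> R) :
  (forall c d, [/\ subpred (ax c d) (qx d), subpred (ay c d) (qy d) &
                   subpred (az c d) (qz d)]) ->
  (forall (x y z : D -> X) c c' c'', (forall d, t (x d) (y d) (z d) != 0) ->
     (forall d, ax c d (p (x d))) -> (forall d, ay c' d (p (y d))) ->
     (forall d, az c'' d (p (z d))) -> c = c' /\ c = c'') ->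
  (forall c, family_achieves rho p t D (ax c) (ay c) (az c) (r c)) ->
  family_achieves rho p t D qx qy qz (\sum_c r c).
Proof.
move=> sub nc h; apply: (achieves_union _ _ (fun c (i : {ffun D -> I}) => [forall d, ax c d (i d)])
  (fun c i => [forall d, ay c d (i d)]) (fun c i => [forall d, az c d (i d)])) h.
- move=> c; split=> i /forallP hi; apply/forallP => d; have [sx sy sz] := sub c d.
  + exact/sx/hi.
  + exact/sy/hi.
  + exact/sz/hi.
- move=> x y z c c' c'' nz /forallP hx /forallP hy /forallP hz; apply: (nc x y z).
  + move=> d; move: nz; rewrite /tensor_family prodf_seq_neq0 => /allP /(_ d).
    by rewrite mem_index_enum => /(_ isT).
  + by move=> d; have := hx d; rewrite ffunE.
  + by move=> d; have := hy d; rewrite ffunE.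
  + by move=> d; have := hz d; rewrite ffunE.
Qed.

(** * Powers of a tensor multiplied by its two rotations *)

Section TriplePower.
Context {R : realType} {F : fieldType}.

Definition rot_prod (E : etensor R F) : etensor R F :=
  etensor_prod (etensor_prod E (etensor_rot E)) (etensor_rot (etensor_rot E)).

Variables (E : etensor R F) (n : nat).
Local Notation En := (etensor_pow (rot_prod E) n).

(* The constituent of [E] which occurs, rotated [r] times, in the factor [l] of the
   constituent [s]. *)
Definition rot_annot (s : annot En) (l : 'I_n) (r : nat) : annot E :=
  rot3 ((s.1.1 l).1.1, (s.1.2 l).1.1, (s.2 l).1.1)
       ((s.2 l).1.2, (s.1.1 l).1.2, (s.1.2 l).1.2)
       ((s.1.2 l).2, (s.2 l).2, (s.1.1 l).2) r.

Lemma est_rot_annot rho (s : annot En) :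
  @est R F En rho s = \prod_(d : 'I_n * 'I_3) @est R F E rho (rot_annot s d.1 d.2).
Proof.
rewrite -(pair_bigA _ (fun l (r : 'I_3) => @est R F E rho (rot_annot s l r))) /=.
by apply: eq_bigr => l _; rewrite !big_ord_recr /= big_ord0 mul1r.
Qed.

Lemma supp_rot_annotP (s : annot En) :
  s \in supp En <-> forall (l : 'I_n) (r : 'I_3), rot_annot s l r \in supp E.
Proof.
split.
  move=> /(@suppP F En) [x [y [z [/= /ffunP hx /ffunP hy /ffunP hz nz]]]] l r.
  have {nz} : coef (x l).1.1 (y l).1.1 (z l).1.1 * coef (z l).1.2 (x l).1.2 (y l).1.2 *
      coef (y l).2 (z l).2 (x l).2 != 0.
    move: nz; rewrite /tensor_family prodf_seq_neq0 => /allP /(_ l).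
    by rewrite mem_index_enum => /(_ isT).
  rewrite !mulf_eq0 !negb_or => /andP[/andP[n0 n1] n2].
  move: (hx l) (hy l) (hz l); rewrite !ffunE /rot_annot => <- <- <-.
  case: r => [[|[|[|//]]] ir]; apply/(@suppP F E) => /=.
  - by exists (x l).1.1, (y l).1.1, (z l).1.1.
  - by exists (z l).1.2, (x l).1.2, (y l).1.2.
  - by exists (y l).2, (z l).2, (x l).2.
move=> h.
have {}h l r : {v : xvar E * yvar E * zvar E |
   (xpart v.1.1, ypart v.1.2, zpart v.2) = rot_annot s l r /\ coef v.1.1 v.1.2 v.2 != 0}.
  apply: cid; have /suppP [x [y [z [hx hy hz nz]]]] : rot_annot s l r \in supp E.
    by rewrite /rot_annot -rot3_mod; have := h l (Ordinal (ltn_pmod r (isT : 0 < 3)%N)).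
  by exists (x, y, z); rewrite /= hx hy hz; case: (rot_annot s l r) => -[].
pose w l r := sval (h l r).
have hw l r := svalP (h l r).
apply/(@suppP F En).
(* The first axis of the product consists of the [x]-axis of the factor, the [y]-axis of its
   rotation and the [z]-axis of its second rotation; the other two axes are obtained by shifting
   cyclically. *)
exists [ffun l => (((w l 0%N).1.1, (w l 1%N).1.2), (w l 2).2)].
exists [ffun l => (((w l 0%N).1.2, (w l 1%N).2), (w l 2).1.1)].
exists [ffun l => (((w l 0%N).2, (w l 1%N).1.1), (w l 2).1.2)].
split.
- apply/ffunP => l; rewrite !ffunE /=.
  have [[e0 _ _] _] := hw l 0%N; have [[_ e1 _] _] := hw l 1%N; have [[_ _ e2] _] := hw l 2.
  by rewrite e0 e1 e2 /=; case: (s.1.1 l) => -[].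
- apply/ffunP => l; rewrite !ffunE /=.
  have [[_ e0 _] _] := hw l 0%N; have [[_ _ e1] _] := hw l 1%N; have [[e2 _ _] _] := hw l 2.
  by rewrite e0 e1 e2 /=; case: (s.1.2 l) => -[].
- apply/ffunP => l; rewrite !ffunE /=.
  have [[_ _ e0] _] := hw l 0%N; have [[e1 _ _] _] := hw l 1%N; have [[_ e2 _] _] := hw l 2.
  by rewrite e0 e1 e2 /=; case: (s.2 l) => -[].
- rewrite /= /tensor_family prodf_seq_neq0; apply/allP => l _ /=; rewrite !ffunE /=.
  have [_ n0] := hw l 0%N; have [_ n1] := hw l 1%N; have [_ n2] := hw l 2.
  exact: (mulf_neq0 (mulf_neq0 n0 n1) n2).
Qed.

(** The mixed annotation has only kept indices, so it survives once it lies in the support. It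
    shares an index with each of [s0], [s1], [s2], and strong disjointness identifies it with all
    three. *)
Lemma strongly_disjoint_mix (A : kept En) (s0 s1 s2 : annot En) :
  strongly_disjoint (supp (prestrict A)) ->
  s0 \in supp (prestrict A) -> s1 \in supp (prestrict A) -> s2 \in supp (prestrict A) ->
  (forall l (r : 'I_3), rot_annot (s0.1.1, s1.1.2, s2.2) l r \in supp E) ->
  s0 = s1 /\ s0 = s2.
Proof.
move=> sd h0 h1 h2 /supp_rot_annotP hs.
have [_ [a0 _ _]] := elimT (@supp_prestrictP F En A s0) h0.
have [_ [_ a1 _]] := elimT (@supp_prestrictP F En A s1) h1.
have [_ [_ _ a2]] := elimT (@supp_prestrictP F En A s2) h2.
have {}hs : (s0.1.1, s1.1.2, s2.2) \in supp (prestrict A).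
  by apply/(@supp_prestrictP F En A).
move: sd => /forallP sd.
have aux s' : s' \in supp (prestrict A) ->
    [\/ s0.1.1 = s'.1.1, s1.1.2 = s'.1.2 | s2.2 = s'.2] -> (s0.1.1, s1.1.2, s2.2) = s'.
  move=> h' e; apply/eqP; apply/negPn/negP => ne.
  have := sd (s0.1.1, s1.1.2, s2.2); rewrite hs /= => /forallP /(_ s'); rewrite h' ne /=.
  by move=> /and3P[/eqP ? /eqP ? /eqP ?]; case: e.
have e0 := aux s0 h0 (Or31 _ _ erefl); have e1 := aux s1 h1 (Or32 _ _ erefl).
by have e2 := aux s2 h2 (Or33 _ _ erefl); rewrite -e0 -{1}e1 -{1}e2.
Qed.

End TriplePower.

(** * Restrictions inside a single block *)

Section InnerValue.
Context {R : realType} {rho : R} {F : fieldType} {q : nat}.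
Local Notation T := (cw R F q).
Local Notation B := (etensor_prod T T).
Local Notation X2 := ('I_q.+2 * 'I_q.+2)%type.
Local Notation I2 := ('I_3 * 'I_3)%type.
Local Notation p2 := (@cw2_part q).
Local Notation t2 := (@cw2_coef F q).
Context {I J K : finType}.
Variables (fx : I2 -> I) (fy : I2 -> J) (fz : I2 -> K).
Local Notation TT := (@repartition R F T T I J K fx fy fz).
Variable b : annot TT.
Local Notation CB := (@coarse_block R F B I J K fx fy fz b).

Definition block_axis (a : annot CB) (n : nat) : I2 :=
  rot3 (sval a.1.1) (sval a.1.2) (sval a.2) n.

Lemma supp_coarse_blockP (a : annot CB) :
  a \in supp CB <-> exists x y z : X2,
    [/\ p2 x = sval a.1.1, p2 y = sval a.1.2, p2 z = sval a.2 & t2 x y z != 0].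
Proof.
case: a => -[[u hu] [v hv]] [w hw] /=; split.
  move=> /(@suppP F CB) [[x hx] [[y hy] [[z hz] [/= ex ey ez nz]]]].
  by exists x, y, z; split=> //; [move: ex|move: ey|move: ez] => /(congr1 sval).
move=> [x [y [z [ex ey ez nz]]]]; apply/(@suppP F CB).
have hx : fx (p2 x) == b.1.1 by rewrite ex.
have hy : fy (p2 y) == b.1.2 by rewrite ey.
have hz : fz (p2 z) == b.2 by rewrite ez.
exists (exist _ x hx), (exist _ y hy), (exist _ z hz).
by split=> //; apply: val_inj.
Qed.

Lemma coarse_block_mm (a : annot CB) : a \in supp CB ->
  exists v, v%:R `^ (rho / 3) = @est R F CB rho a /\
    forall n, mm_on t2 (preim p2 (pred1 (block_axis a n)))
      (preim p2 (pred1 (block_axis a n.+1))) (preim p2 (pred1 (block_axis a n.+2))) v.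
Proof.
move=> /supp_coarse_blockP [x [y [z [ex ey ez nz]]]].
have [v [m e]] := cw2_mm (rho := rho) x y z nz; exists v; split.
  by move: e; rewrite ex ey ez /= => <-.
move=> n; have := mm_on_rot3 cw2_coef_cyclic _ _ _ _ n m; rewrite ex ey ez.
apply: mm_on_eq => // w;
exact: (rot3P _ _ _ _ _ _ (fun (k : pred X2) (c : I2) => k w = preim p2 (pred1 c) w)).
Qed.

Lemma block_axis_in (a : annot CB) k : in_axis fx fy fz b k (block_axis a k).
Proof.
rewrite /block_axis /in_axis; case: a => -[[u hu] [u' hu']] [u'' hu''] /=.
by rewrite /rot3; case: (k %% 3)%N => [|[|?]].
Qed.

Section Restriction.
Variable n : nat.
Local Notation En := (etensor_pow (rot_prod CB) n).
Local Notation rota := (rot_annot CB n).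

Lemma block_axis_mix (A : kept En) (s0 s1 s2 : annot En) (x y z : 'I_n * 'I_3 -> X2) :
  strongly_disjoint (supp (prestrict A)) ->
  s0 \in supp (prestrict A) -> s1 \in supp (prestrict A) -> s2 \in supp (prestrict A) ->
  (forall d, t2 (x d) (y d) (z d) != 0) ->
  (forall d, p2 (x d) = block_axis (rota s0 d.1 d.2) d.2) ->
  (forall d, p2 (y d) = block_axis (rota s1 d.1 d.2) d.2.+1) ->
  (forall d, p2 (z d) = block_axis (rota s2 d.1 d.2) d.2.+2) -> s0 = s1 /\ s0 = s2.
Proof.
move=> sd h0 h1 h2 nz hx hy hz.
apply: (strongly_disjoint_mix CB n A s0 s1 s2 sd h0 h1 h2) => l r.
apply/supp_coarse_blockP.
move: (nz (l, r)) (hx (l, r)) (hy (l, r)) (hz (l, r)).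
(* Undoing the rotation permutes [x], [y], [z] cyclically, and the coefficient stays the same by
   cyclic invariance. *)
case: r => [[|[|[|//]]] ir] n0 ex ey ez.
+ by exists (x (l, Ordinal ir)), (y (l, Ordinal ir)), (z (l, Ordinal ir)).
+ exists (z (l, Ordinal ir)), (x (l, Ordinal ir)), (y (l, Ordinal ir)); split=> //.
  by rewrite cw2_coef_cyclic.
+ exists (y (l, Ordinal ir)), (z (l, Ordinal ir)), (x (l, Ordinal ir)); split=> //.
  by rewrite -cw2_coef_cyclic.
Qed.

Lemma block_achieves_term (s : annot En) : s \in supp En ->
  family_achieves rho p2 t2 ('I_n * 'I_3)%type
    (fun d => pred1 (block_axis (rota s d.1 d.2) d.2))
    (fun d => pred1 (block_axis (rota s d.1 d.2) d.2.+1))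
    (fun d => pred1 (block_axis (rota s d.1 d.2) d.2.+2)) (@est R F En rho s).
Proof.
move=> /supp_rot_annotP h.
have /choice [v hv] : forall d : 'I_n * 'I_3, exists v,
    v%:R `^ (rho / 3) = @est R F CB rho (rota s d.1 d.2) /\
    forall n, mm_on t2 (preim p2 (pred1 (block_axis (rota s d.1 d.2) n)))
      (preim p2 (pred1 (block_axis (rota s d.1 d.2) n.+1)))
      (preim p2 (pred1 (block_axis (rota s d.1 d.2) n.+2))) v.
  by move=> d; apply: coarse_block_mm; apply: h.
have hm d := (hv d).2 d.2.
rewrite est_rot_annot; under eq_bigr => d _ do rewrite -(hv d).1.
exact: family_achieves_mm hm.
Qed.

(** Every constituent left by a strongly disjoint restriction becomes a region of its own;
    [block_axis_mix] excludes cross terms between them. *)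
Lemma block_achieves_Vpr :
  block_achieves (rho := rho) (F := F) (q := q) fx fy fz b n (Vpr_pow CB rho n).
Proof.
rewrite /Vpr_pow /max_disjoint_value; apply: big_ind.
- exact: achieves0.
- by move=> x y hx hy; rewrite /Num.max; case: ifP.
move=> A sd; rewrite big_sub.
pose C : finType := {s in supp (@prestrict F En A)}.
pose D : finType := ('I_n * 'I_3)%type.
refine (@family_achieves_union R rho F X2 I2 C D p2 t2
  (fun s d => pred1 (block_axis (rota (val s) d.1 d.2) d.2))
  (fun s d => pred1 (block_axis (rota (val s) d.1 d.2) d.2.+1))
  (fun s d => pred1 (block_axis (rota (val s) d.1 d.2) d.2.+2))
  (fun d => in_axis fx fy fz b d.2) (fun d => in_axis fx fy fz b d.2.+1)
  (fun d => in_axis fx fy fz b d.2.+2) (fun s => @est R F En rho (val s)) _ _ _).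
- by move=> s d; split=> i /eqP ->; apply: block_axis_in.
- move=> x y z s0 s1 s2 nz hx hy hz.
  have [] := block_axis_mix A (val s0) (val s1) (val s2) x y z sd (valP s0) (valP s1) (valP s2) nz
    (fun d => eqP (hx d)) (fun d => eqP (hy d)) (fun d => eqP (hz d)).
  by move=> e e'; split; apply: val_inj.
- move=> s; apply: block_achieves_term.
  by have [] := elimT (@supp_prestrictP F En A (val s)) (valP s).
Qed.

End Restriction.
End InnerValue.

(** * The blocks of a repartitioning *)

Lemma Vpr_pow_ge0 {R : realType} {F : fieldType} (E : etensor R F) rho n :
  0 <= Vpr_pow E rho n.
Proof. exact: bigmax_ge_id. Qed.

Lemma Vpr_ge0 {R : realType} {F : fieldType} (E : etensor R F) rho : 0 <= Vpr E rho.
Proof.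
rewrite /Vpr; case: (pselect (cvgn (fun N => Vpr_pow E rho N `^ (3 * N)%:R^-1))) => [cv|dv].
  by apply: limr_ge => //; near=> n; apply: powR_ge0.
by rewrite dvgP.
Unshelve. all: by end_near.
Qed.

(* A divergent sequence has the junk limit [0], so [0 < Vpr] forces convergence. *)
Lemma Vpr_pow_lower {R : realType} {F : fieldType} (E : etensor R F) rho (L : R) :
  0 <= L < Vpr E rho ->
  exists n0, forall n, (n0 <= n)%N -> L ^+ (3 * n) <= Vpr_pow E rho n.
Proof.
move=> /andP[L0 LV].
case: (pselect (cvgn (fun N => Vpr_pow E rho N `^ (3 * N)%:R^-1))) => [cv|dv]; last first.
  by move: LV; rewrite /Vpr dvgP // ltNge L0.
have [n0 _ h] : \forall n \near \oo%classic, L < Vpr_pow E rho n `^ (3 * n)%:R^-1.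
  exact: (cvgr_gt _ cv).
(* Starting above 0 makes the exponent of the root invertible. *)
exists n0.+1 => n hn.
have n1 : (0 < 3 * n)%N by rewrite muln_gt0 (leq_trans _ hn).
have -> : Vpr_pow E rho n = (Vpr_pow E rho n `^ (3 * n)%:R^-1) ^+ (3 * n).
  rewrite -powR_mulrn ?powR_ge0 // -powRrM mulVf ?powRr1 ?Vpr_pow_ge0 //.
  by rewrite pnatr_eq0 -lt0n.
by apply: lerXn2r; rewrite ?nnegrE ?powR_ge0 // ltW // h //= ltnW.
Qed.

Section Outer.
Context {R : realType} {rho : R} {F : fieldType} {q : nat}.
Hypotheses (rho0 : 0 <= rho) (rho3 : rho <= 3).
Local Notation T := (cw R F q).
Local Notation X2 := ('I_q.+2 * 'I_q.+2)%type.
Local Notation I2 := ('I_3 * 'I_3)%type.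
Local Notation p2 := (@cw2_part q).
Local Notation t2 := (@cw2_coef F q).
Context {I J K : finType}.
Variables (fx : I2 -> I) (fy : I2 -> J) (fz : I2 -> K).
Local Notation TT := (@repartition R F T T I J K fx fy fz).
Local Notation IJK := (I * J * K)%type.
Local Notation blocks_achieve := (block_achieves (rho := rho) (F := F) (q := q) fx fy fz).
Local Notation in_ax := (in_axis fx fy fz).

Lemma family_achieves_empty (D : finType) (qx qy qz : D -> pred I2) :
  #|D| = 0%N -> family_achieves rho p2 t2 D qx qy qz 1.
Proof.
move=> /card0_eq D0; have h d : mm_on t2 (preim p2 (qx d)) (preim p2 (qy d)) (preim p2 (qz d)) 1%N.
  by have := D0 d.
have := family_achieves_mm (rho := rho) _ _ _ _ h.
by rewrite big_pred0 // => d; have := D0 d.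
Qed.

Lemma est_ge0 (b : annot TT) : 0 <= @est R F TT rho b.
Proof. by rewrite /=; case: ifP => _; [apply: powR_ge0|apply: Vpr_ge0]. Qed.

(** One constant has to serve every count [n]: [dl] covers the distance to the limit [Vpr] for large
    [n], and [c] covers the finitely many smaller ones. *)
Lemma block_lower_bound (dl : R) (b : annot TT) : 0 < dl < 1 ->
  exists c : R, 0 < c /\ forall n, ((0 < n)%N -> b \in supp TT) ->
    blocks_achieve b n (c * (@est R F TT rho b * dl) ^+ (3 * n)).
Proof.
move=> /andP[dl0 dl1].
have [hb|hb] := boolP (b \in supp TT); last first.
  (* Outside the support only [n = 0] is allowed, where the empty product has value 1. *)
  exists 1; split=> // -[|n] hn; last by have := hn isT.
  by rewrite muln0 expr0 mulr1; apply: family_achieves_empty; rewrite card_prod !card_ord.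
have h1 n := block_achieves1 (rho := rho) rho0 fx fy fz b n hb.
have [mm|nmm] := pselect (is_matmul (constituent b)).
  exists 1; split=> // n _; rewrite mul1r.
  have hm := block_achieves_mm (rho := rho) fx fy fz b n mm.
  apply: achieves_le hm; rewrite /= asboolT //.
  apply: lerXn2r; rewrite ?nnegrE ?mulr_ge0 ?powR_ge0 ?(ltW dl0) //.
  by rewrite ler_piMr ?powR_ge0 // ltW.
have hV n := block_achieves_Vpr (rho := rho) fx fy fz b n.
have -> : @est R F TT rho b = Vpr (@coarse_block R F (etensor_prod T T) I J K fx fy fz b) rho.
  by rewrite /= asboolF.
set V := Vpr _ _.
have V0 : 0 <= V by apply: Vpr_ge0.
(* If the limit is 0, the value asked for is 0, or 1 when [n = 0]. *)
have [VE|Vn] := eqVneq V 0.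
  exists 1; split=> // n _; apply: achieves_le (h1 n); rewrite VE mul0r mul1r.
  by rewrite expr0n; case: (_ == _).
have Vp : 0 < V by rewrite lt_def Vn.
have [n0 hn0] : exists n0, forall n, (n0 <= n)%N ->
    (V * dl) ^+ (3 * n) <= Vpr_pow (@coarse_block R F (etensor_prod T T) I J K fx fy fz b) rho n.
  apply: Vpr_pow_lower; rewrite mulr_ge0 ?(ltW dl0) //=.
  by rewrite gtr_pMr.
(* For [n < n0] the bound [(V * dl) ^+ (3 * n) <= m ^+ (3 * n0)] brings the required value below 1,
   which [block_achieves1] provides. *)
pose m := Num.max 1 (V * dl).
have m1 : 1 <= m by rewrite le_max lexx.
have mp k : 0 < m ^+ k by rewrite exprn_gt0 // (lt_le_trans _ m1).
exists (m ^+ (3 * n0))^-1; split; first by rewrite invr_gt0.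
have Vd0 : 0 <= V * dl by rewrite mulr_ge0 // ltW.
move=> n _; have [hn|hn] := leqP n0 n.
  apply: achieves_le (hV n); apply: le_trans (hn0 n hn).
  by rewrite ler_piMl ?exprn_ge0 // invf_le1 // exprn_ege1.
apply: achieves_le (h1 n); rewrite mulrC ler_pdivrMr // mul1r.
apply: (@le_trans _ _ (m ^+ (3 * n))).
  apply: lerXn2r; rewrite ?nnegrE //; first by apply: le_trans m1.
  by rewrite /m le_max lexx orbT.
by rewrite ler_weXn2l // leq_mul2l ltnW.
Qed.

(** Only the residue of [ro d] modulo 3 matters, and each residue occurs [n] times, so [D] is in
    bijection with ['I_n * 'I_3] compatibly with the rotations. *)
Lemma family_achieves_block (D : finType) (bt : IJK) (ro : D -> nat) n r :
  (forall k : 'I_3, #|[set d | (ro d %% 3)%N == k]| = n) ->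
  blocks_achieve bt n r ->
  family_achieves rho p2 t2 D (fun d => in_ax bt (ro d)) (fun d => in_ax bt (ro d).+1)
    (fun d => in_ax bt (ro d).+2) r.
Proof.
move=> hn.
pose e (a : 'I_n * 'I_3) : D := enum_val (cast_ord (esym (hn a.2)) a.1).
have em a : (ro (e a) %% 3)%N = a.2.
  have := enum_valP (cast_ord (esym (hn a.2)) a.1); rewrite inE => /eqP; exact.
have ei : injective e.
  move=> [l k] [l' k'] h; have hk : k = k' by apply: val_inj; rewrite /= -(em (l, k)) h em.
  by subst k'; congr (_, _); apply: (@cast_ord_inj _ _ (esym (hn k))); apply: enum_val_inj.
have eb : bijective e.
  apply: inj_card_bij => //; rewrite card_prod !card_ord.
  rewrite -sum1_card (partition_big (fun d => inord (ro d %% 3) : 'I_3) xpredT) //=.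
  rewrite -[X in (_ <= n * X)%N](card_ord 3) mulnC -sum_nat_const.
  apply: leq_sum => k _; rewrite sum1_card -(hn k) subset_leq_card //.
  apply/fintype.subsetP => d hd; rewrite inE; move: hd; rewrite unfold_in => /eqP <-; rewrite /= inordK //.
  exact: ltn_pmod.
have hE (d : 'I_n * 'I_3) k u : in_ax bt (d.2 + k) u = in_ax bt (ro (e d) + k) u.
  by rewrite -[RHS]in_axis_mod -modnDml em in_axis_mod.
apply: (family_achieves_iso e) => // d u.
- by have := hE d 0%N u; rewrite !addn0.
- by have := hE d 1%N u; rewrite !addn1.
- by have := hE d 2 u; rewrite !addn2.
Qed.

Lemma family_achieves_blocks (D : finType) (bt : D -> IJK) (ro : D -> nat)
    (n : IJK -> nat) (r : IJK -> R) :
  (forall b (k : 'I_3), #|[set d | (bt d == b) && ((ro d %% 3)%N == k)]| = n b) ->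
  (forall b, 0 <= r b) -> (forall b, blocks_achieve b (n b) (r b)) ->
  family_achieves rho p2 t2 D (fun d => in_ax (bt d) (ro d)) (fun d => in_ax (bt d) (ro d).+1)
    (fun d => in_ax (bt d) (ro d).+2) (\prod_b r b).
Proof.
move=> hn r0 hr.
(* The induction splits off the positions of one block at a time, so the set of positions has to
   vary with the list of remaining blocks. *)
suff aux (L : seq IJK) : uniq L -> forall (D : finType) (bt : D -> IJK) (ro : D -> nat),
    (forall d, bt d \in L) ->
    (forall b (k : 'I_3), b \in L ->
      #|[set d | (bt d == b) && ((ro d %% 3)%N == k)]| = n b) ->
    family_achieves rho p2 t2 D (fun d => in_ax (bt d) (ro d))
      (fun d => in_ax (bt d) (ro d).+1) (fun d => in_ax (bt d) (ro d).+2)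
      (\prod_(b <- L) r b).
  by apply: aux; [exact: index_enum_uniq|move=> d; exact: mem_index_enum|move=> b k _].
elim: L {D bt ro hn} => [_|b L IH /= /andP[bL uL]] D bt ro hL hn.
  rewrite big_nil; apply: family_achieves_empty; apply: eq_card0 => d.
  by have := hL d.
rewrite big_cons; apply: (family_achieves_split (fun d => bt d == b)) => //.
- by apply: prodr_ge0.
- have hk (k : 'I_3) : #|[set d : {d | bt d == b} | (ro (val d) %% 3)%N == k]| = n b.
    rewrite -(hn b k) ?mem_head // -(card_imset _ val_inj); apply: eq_card => d.
    rewrite inE; apply/imsetP/andP => [[d' + ->]|[hd hk]].
      by rewrite inE => ?; split=> //; apply: (valP d').
    by exists (exist _ d hd) => //; rewrite inE.
  have := family_achieves_block _ b (ro \o val) (n b) (r b) hk (hr b).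
  apply: achieves_sub => i /forallP hi; apply/forallP => d;
  by rewrite /= (eqP (valP d)); apply: hi.
- apply: IH => // [d|b' k hb'].
    by have := hL (val d); rewrite inE (negbTE (valP d)).
  rewrite -(hn b' k) ?inE ?hb' ?orbT // -(card_imset _ val_inj); apply: eq_card => d.
  rewrite inE; apply/imsetP/andP => [[d' + ->]|[hd hk]]; first by rewrite inE => /andP.
  have hd' : bt d != b by apply: contraNneq bL => <-; rewrite (eqP hd).
  by exists (exist _ d hd') => //; rewrite inE hd.
Qed.

Lemma cw_achieves_double (D : finType) (qx qy qz : D -> pred I2) r :
  family_achieves rho p2 t2 D qx qy qz r ->
  cw_achieves (rho := rho) (F := F) (q := q) (D + D)%type r.
Proof.
apply: (achieves_iso (fun x : {ffun D -> X2} =>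
    [ffun d => match d with inl d => (x d).1 | inr d => (x d).2 end] : {ffun D + D -> 'I_q.+2})
  (fun i : {ffun D + D -> 'I_3} => [ffun d => (i (inl d), i (inr d))])) => //.
- exists (fun x : {ffun D + D -> 'I_q.+2} => [ffun d => (x (inl d), x (inr d))]).
    by move=> x; apply/ffunP => d; rewrite !ffunE -surjective_pairing.
  by move=> x; apply/ffunP => -[] d; rewrite !ffunE.
- move=> x y z; rewrite /tensor_family big_sumType /= -big_split /=.
  by apply: eq_bigr => d _; rewrite !ffunE.
- by move=> x; apply/ffunP => d; rewrite !ffunE.
Qed.

End Outer.

(** * Rotated copies of a restriction *)

(** Bernoulli's inequality for the (k+1)-st root [y] of [g] gives y^n >= d (n+1), hence g^n >=
    d^(k+1) (n+1)^(k+1). The surplus factor n+1 overcomes the constants. *)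
Lemma exp_beats_power {R : realType} (g C : R) (k n0 : nat) : 1 < g -> 0 < C ->
  exists n, (n0 <= n)%N /\ (n.+1 ^ k)%:R < C * g ^+ n.
Proof.
move=> g1 C0; pose y := g `^ k.+1%:R^-1.
have y1 : 1 < y.
  rewrite /y /powR gt_eqF ?(lt_trans _ g1) // expR_gt1 mulr_gt0 ?invr_gt0 ?ltr0n //.
  exact: ln_gt0.
have gE : g = y ^+ k.+1.
  rewrite -powR_mulrn ?powR_ge0 // -powRrM mulVf ?pnatr_eq0 // powRr1 //.
  by rewrite ltW // (lt_trans _ g1).
pose d := Num.min 1 (y - 1).
have d0 : 0 < d by rewrite lt_min ltr01 subr_gt0.
have d1 : d <= 1 by rewrite ge_min lexx.
have dy : d <= y - 1 by rewrite ge_min lexx orbT.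
have bern n : d * n.+1%:R <= y ^+ n.
  elim: n => [|n IH]; first by rewrite mulr1 expr0.
  have -> : y ^+ n.+1 = y ^+ n + (y - 1) * y ^+ n by rewrite exprS; ring.
  rewrite -[X in d * X]natr1 mulrDr mulr1.
  apply: lerD => //; rewrite -[d]mulr1; apply: ler_pM => //; first exact: ltW.
  by rewrite exprn_ege1 // ltW.
pose e := C * d ^+ k.+1.
have e0 : 0 < e by rewrite mulr_gt0 // exprn_gt0.
pose n := maxn n0 (Num.bound e^-1).
exists n; split; first exact: leq_maxl.
have hn : 1 < e * n.+1%:R.
  rewrite mulrC -ltr_pdivrMr // mul1r.
  apply: lt_le_trans (archi_boundP _) _; first by rewrite invr_ge0 ltW.
  by rewrite ler_nat leqW // leq_maxr.
apply: (@lt_le_trans _ _ (e * n.+1%:R ^+ k.+1)).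
  by rewrite natrX exprS mulrA ltr_pMl // exprn_gt0 // ltr0n.
rewrite /e -mulrA -exprMn ler_pM2l // gE -exprM mulnC exprM.
by apply: lerXn2r; rewrite ?nnegrE ?mulr_ge0 ?exprn_ge0 ?(ltW d0) // ltW // (lt_trans _ y1).
Qed.

Section OuterUnion.
Context {R : realType} {rho : R} {F : fieldType} {q : nat}.
Local Notation T := (cw R F q).
Local Notation X2 := ('I_q.+2 * 'I_q.+2)%type.
Local Notation I2 := ('I_3 * 'I_3)%type.
Local Notation p2 := (@cw2_part q).
Local Notation t2 := (@cw2_coef F q).
Context {I J K : finType}.
Variables (fx : I2 -> I) (fy : I2 -> J) (fz : I2 -> K).
Local Notation TT := (@repartition R F T T I J K fx fy fz).
Local Notation IJK := (I * J * K)%type.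
Local Notation blocks_achieve := (block_achieves (rho := rho) (F := F) (q := q) fx fy fz).
Local Notation in_ax := (in_axis fx fy fz).

Section Power.
Variable N : nat.
Local Notation En := (etensor_pow (rot_prod TT) N).
Local Notation rota := (rot_annot TT N).

Lemma in_axis_mix (A : kept En) (s0 s1 s2 : annot En) (x y z : 'I_N * 'I_3 -> X2) :
  strongly_disjoint (supp (prestrict A)) ->
  s0 \in supp (prestrict A) -> s1 \in supp (prestrict A) -> s2 \in supp (prestrict A) ->
  (forall d, t2 (x d) (y d) (z d) != 0) ->
  (forall d : 'I_N * 'I_3, in_ax (rota s0 d.1 d.2) d.2 (p2 (x d))) ->
  (forall d : 'I_N * 'I_3, in_ax (rota s1 d.1 d.2) d.2.+1 (p2 (y d))) ->
  (forall d : 'I_N * 'I_3, in_ax (rota s2 d.1 d.2) d.2.+2 (p2 (z d))) -> s0 = s1 /\ s0 = s2.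
Proof.
move=> sd h0 h1 h2 nz hx hy hz.
apply: (strongly_disjoint_mix TT N A s0 s1 s2 sd h0 h1 h2) => l r.
apply/(@suppP F TT).
move: (nz (l, r)) (hx (l, r)) (hy (l, r)) (hz (l, r)).
case: r => [[|[|[|//]]] ir] n0 ex ey ez; move: n0 ex ey ez; set o := Ordinal ir.
+ move=> n0 ex ey ez; exists (x (l, o)), (y (l, o)), (z (l, o)).
  by split; [apply/eqP; exact: ex|apply/eqP; exact: ey|apply/eqP; exact: ez|exact: n0].
+ move=> n0 ex ey ez; exists (z (l, o)), (x (l, o)), (y (l, o)).
  split; [apply/eqP; exact: ez|apply/eqP; exact: ex|apply/eqP; exact: ey|].
  by rewrite cw2_coef_cyclic in n0; rewrite cw2_coef_cyclic in n0.
+ move=> n0 ex ey ez; exists (y (l, o)), (z (l, o)), (x (l, o)).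
  split; [apply/eqP; exact: ey|apply/eqP; exact: ez|apply/eqP; exact: ex|].
  by rewrite cw2_coef_cyclic in n0.
Qed.

(** In the copy rotated [c] times the three variables lie on axes shifted by [c]; permuting their
    roles cyclically reduces to [in_axis_mix]. *)
Lemma in_axis_mix_rot (A : kept En) (s0 s1 s2 : annot En) (x y z : 'I_N * 'I_3 -> X2)
    (c : nat) : (c < 3)%N ->
  strongly_disjoint (supp (prestrict A)) ->
  s0 \in supp (prestrict A) -> s1 \in supp (prestrict A) -> s2 \in supp (prestrict A) ->
  (forall d, t2 (x d) (y d) (z d) != 0) ->
  (forall d : 'I_N * 'I_3, in_ax (rota s0 d.1 d.2) (c + d.2 + 0) (p2 (x d))) ->
  (forall d : 'I_N * 'I_3, in_ax (rota s1 d.1 d.2) (c + d.2 + 1) (p2 (y d))) ->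
  (forall d : 'I_N * 'I_3, in_ax (rota s2 d.1 d.2) (c + d.2 + 2) (p2 (z d))) ->
  s0 = s1 /\ s0 = s2.
Proof.
have per bb k u : in_ax bb k.+3 u = in_ax bb k u by rewrite /in_axis rot3_period.
move=> hc sd h0 h1 h2 nz hx hy hz.
have {}hx (d : 'I_N * 'I_3) : in_ax (rota s0 d.1 d.2) (c + d.2) (p2 (x d)).
  by rewrite -[X in in_ax _ X]addn0; exact: hx.
have {}hy (d : 'I_N * 'I_3) : in_ax (rota s1 d.1 d.2) (c + d.2).+1 (p2 (y d)).
  by rewrite -[X in in_ax _ X]addn1; exact: hy.
have {}hz (d : 'I_N * 'I_3) : in_ax (rota s2 d.1 d.2) (c + d.2).+2 (p2 (z d)).
  by rewrite -[X in in_ax _ X]addn2; exact: hz.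
case: c hc hx hy hz => [|[|[|//]]] _ hx hy hz.
- exact: (in_axis_mix A s0 s1 s2 x y z sd h0 h1 h2 nz hx hy hz).
- have nz' d : t2 (z d) (x d) (y d) != 0 by rewrite cw2_coef_cyclic.
  have hz' (d : 'I_N * 'I_3) : in_ax (rota s2 d.1 d.2) d.2 (p2 (z d)) by rewrite -per; exact: hz.
  by have [<- <-] := in_axis_mix A s2 s0 s1 z x y sd h2 h0 h1 nz' hz' hx hy.
- have nz' d : t2 (y d) (z d) (x d) != 0 by rewrite -cw2_coef_cyclic.
  have hy' (d : 'I_N * 'I_3) : in_ax (rota s1 d.1 d.2) d.2 (p2 (y d)) by rewrite -per; exact: hy.
  have hz' (d : 'I_N * 'I_3) : in_ax (rota s2 d.1 d.2) d.2.+1 (p2 (z d)) by rewrite -per; exact: hz.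
  by have [<- <-] := in_axis_mix A s1 s2 s0 y z x sd h1 h2 h0 nz' hy' hz' hx.
Qed.

Lemma sum_rot_eq (r k : 'I_3) : (\sum_(c < 3) (((c + r) %% 3)%N == k) = 1)%N.
Proof.
by case: r => [[|[|[|//]]] ir]; case: k => [[|[|[|//]]] ik]; rewrite !big_ord_recl big_ord0.
Qed.

(** For each inner rotation [r] exactly one copy [c] satisfies c + r = k modulo 3. The count
    therefore does not depend on [k], which balances the rotations. *)
Lemma card_rotated (s : 'I_3 -> annot En) (cnt : 'I_3 -> nat) b (k : 'I_3) :
  (forall c (r : 'I_3), #|[set l | rota (s c) l r == b]| = cnt r) ->
  #|[set d : 'I_3 * ('I_N * 'I_3) |
      (rota (s d.1) d.2.1 d.2.2 == b) && (((d.1 + d.2.2) %% 3)%N == k)]| = (\sum_r cnt r)%N.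
Proof.
move=> hc.
transitivity (\sum_(c < 3) \sum_(l < N) \sum_(r < 3)
    ((rota (s c) l r == b) && (((c + r) %% 3)%N == k) : nat))%N.
  under eq_bigr => c _ do rewrite pair_bigA /=.
  rewrite pair_bigA /= -sum1_card big_mkcond /=; apply: eq_bigr => d _.
  by rewrite inE; case: (_ && _).
transitivity (\sum_(c < 3) \sum_(r < 3) (((c + r) %% 3)%N == k) * cnt r)%N.
  apply: eq_bigr => c _; rewrite exchange_big /=; apply: eq_bigr => r _.
  case: (((c + r) %% 3)%N == k :> nat); last by rewrite big1 // => l _; rewrite andbF.
  rewrite mul1n -(hc c r) -sum1_card [RHS]big_mkcond /=; apply: eq_bigr => l _.
  by rewrite andbT inE; case: (_ == b).
rewrite exchange_big /=; apply: eq_bigr => r _.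
by rewrite -big_distrl /= sum_rot_eq mul1n.
Qed.

(* The position [(c, (l, r))] is the factor [(l, r)] of the copy of the restriction
   which is rotated [c] times, so it carries a block rotated [c + r] times. *)
Lemma outer_achieves (A : kept En) (Sg : {set annot En}) (cnt : IJK -> 'I_3 -> nat)
    (r : IJK -> R) :
  strongly_disjoint (supp (prestrict A)) ->
  {subset Sg <= supp (prestrict A)} ->
  (forall s b (k : 'I_3), s \in Sg -> #|[set l | rota s l k == b]| = cnt b k) ->
  (forall b, 0 <= r b) -> (forall b, blocks_achieve b (\sum_k cnt b k)%N (r b)) ->
  cw_achieves (rho := rho) (F := F) (q := q) 'I_(18 * N) ((#|Sg| ^ 3)%:R * \prod_b r b).
Proof.
move=> sd sub hc r0 hr.
pose D : finType := ('I_3 * ('I_N * 'I_3))%type.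
(* There are 3 copies with [3 N] blocks each, and every block takes 2 factors of [T_cw]. *)
apply: (@cw_achieves_card _ _ _ _ (D + D)%type).
  by rewrite card_sum !card_prod !card_ord; lia.
(* Each of the three copies chooses its constituent independently, whence the cube of [#|Sg|]. *)
pose C : finType := {ffun 'I_3 -> {s in Sg}}.
have mS (f : C) c : val (f c) \in Sg := valP (f c).
have -> : (#|Sg| ^ 3)%:R * \prod_b r b = \sum_(f : C) \prod_b r b.
  by rewrite sumr_const card_ffun card_ord card_sig mulr_natl.
apply: (@cw_achieves_double R rho F q D (fun _ => xpredT) (fun _ => xpredT) (fun _ => xpredT)).
pose ax k (f : C) (d : D) := in_ax (rota (val (f d.1)) d.2.1 d.2.2) (d.1 + d.2.2 + k).
refine (@family_achieves_union R rho F X2 I2 C D p2 t2 (ax 0%N) (ax 1%N) (ax 2)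
  _ _ _ (fun=> \prod_b r b) _ _ _).
- by move=> f d; split.
- move=> x y z f f' f'' nz hx hy hz.
  pose ev c (w : D -> X2) (d : 'I_N * 'I_3) := w (c, d).
  have h c : val (f c) = val (f' c) /\ val (f c) = val (f'' c).
    have m1 := sub _ (mS f c); have m2 := sub _ (mS f' c); have m3 := sub _ (mS f'' c).
    have nzc d : t2 (ev c x d) (ev c y d) (ev c z d) != 0 by exact: nz.
    exact: (in_axis_mix_rot A (val (f c)) (val (f' c)) (val (f'' c)) _ _ _ c (ltn_ord c)
      sd m1 m2 m3 nzc (fun d => hx (c, d)) (fun d => hy (c, d)) (fun d => hz (c, d))).
  by split; apply/ffunP => c; apply: val_inj; case: (h c).
- move=> f.
  have hcard b (k : 'I_3) := card_rotated (fun c => val (f c)) (cnt b) b k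
    (fun c k' => hc _ b k' (mS f c)).
  have := @family_achieves_blocks R rho F q I J K fx fy fz D
    (fun d => rota (val (f d.1)) d.2.1 d.2.2) (fun d => d.1 + d.2.2)%N _ r hcard r0 hr.
  apply: achieves_sub => i /forallP hi; apply/forallP => d; have := hi d;
  by rewrite /ax ?addn0 ?addn1 ?addn2.
Qed.

End Power.

End OuterUnion.

Lemma max_disjoint_value_ind {R : realType} {F : fieldType} (E : etensor R F) rho
    (P : R -> Prop) :
  P 0 -> (forall A : kept E, strongly_disjoint (supp (prestrict A)) ->
            P (\sum_(s in supp (prestrict A)) @est R F E rho s)) ->
  P (max_disjoint_value E rho).
Proof.
move=> P0 PA; apply: big_ind => // x y Px Py.
by rewrite /Num.max; case: ifP.
Qed.

(** If V^2 < L, then for [d] close to 1 the rate g = L d^2 / V^2 exceeds 1, and [C * g ^+ (9 * n)]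
    outgrows the polynomial factor. *)
Lemma root_comparison {R : realType} (w : nat -> R) (L V : R) (k : nat) :
  1 <= V -> (forall n, 0 <= w n) ->
  (forall l, 0 <= l < L -> exists n0, forall n, (n0 <= n)%N -> l ^+ (3 * n) <= w n) ->
  (forall d, 0 < d < 1 -> exists C : R, 0 < C /\ forall n, (0 < n)%N ->
     C * (w n * d ^+ (3 * n)) ^+ 3 <= (n.+1 ^ k)%:R ^+ 3 * V ^+ (18 * n)) ->
  L <= V ^+ 2.
Proof.
move=> V1 w0 hL hV; rewrite leNgt; apply/negP => VL.
have V2p : 0 < V ^+ 2 by rewrite exprn_gt0 // (lt_le_trans _ V1).
have L0 : 0 < L by apply: lt_trans VL.
pose x := V ^+ 2 / L.
have x0 : 0 < x by rewrite divr_gt0.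
have x1 : x < 1 by rewrite ltr_pdivrMr // mul1r.
(* One factor [d] is lost in approaching [L] and another in the upper bound, so [d ^+ 2] must exceed
   [x]: it is at least 1 - (1 - x)/2. *)
pose d := 1 - (1 - x) / 4.
have d0 : 0 < d by rewrite /d; lra.
have d1 : d < 1 by rewrite /d; lra.
have dx : x < d ^+ 2 by rewrite /d; nra.
have [C [C0 hC]] := hV d (introT andP (conj d0 d1)).
have [n0 hn0] : exists n0, forall n, (n0 <= n)%N -> (L * d) ^+ (3 * n) <= w n.
  by apply: hL; rewrite mulr_ge0 ?ltW //= gtr_pMr.
pose g := L * d ^+ 2 / V ^+ 2.
have g1 : 1 < g by rewrite ltr_pdivlMr // mul1r mulrC -ltr_pdivrMr.
(* The polynomial factor enters cubed, hence [k * 3]; [n0.+1] makes [n] positive. *)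
have [n [hn]] := exp_beats_power g C (k * 3) n0.+1 g1 C0.
have np : (0 < n)%N by apply: leq_trans hn.
apply/negP; rewrite -leNgt.
apply: (@le_trans _ _ (C * g ^+ (9 * n))).
  by rewrite ler_pM2l // ler_weXn2l ?(ltW g1) // leq_pmull.
have -> : g ^+ (9 * n) = (L * d ^+ 2) ^+ (9 * n) / V ^+ (18 * n).
  by rewrite /g expr_div_n -exprM; congr (_ / _ ^+ _); lia.
rewrite mulrA ler_pdivrMr ?exprn_gt0 ?(lt_le_trans _ V1) // expnM natrX.
apply: le_trans (hC n np).
rewrite ler_pM2l // (_ : (9 * n)%N = (3 * n * 3)%N); last by lia.
have Ld0 : 0 <= L * d ^+ 2 by rewrite mulr_ge0 ?exprn_ge0 ?ltW.
rewrite exprM; apply: lerXn2r.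
- by rewrite nnegrE exprn_ge0.
- by rewrite nnegrE mulr_ge0 // exprn_ge0 // ltW.
rewrite expr2 mulrA exprMn ler_pM2r ?exprn_gt0 //.
by apply: hn0; apply: ltnW.
Qed.

(** * Sorting the constituents of a restriction by type *)

Section OuterBound.
Context {R : realType} {rho : R} {F : fieldType} {q : nat}.
Hypotheses (rho0 : 0 <= rho) (rho3 : rho <= 3).
Local Notation T := (cw R F q).
Local Notation I2 := ('I_3 * 'I_3)%type.
Context {I J K : finType}.
Variables (fx : I2 -> I) (fy : I2 -> J) (fz : I2 -> K).
Local Notation TT := (@repartition R F T T I J K fx fy fz).
Local Notation IJK := (I * J * K)%type.
Local Notation Vm := (Vm T rho).
Local Notation estTT := (@est R F TT rho).

Lemma prod_rot_annot N (s : annot (etensor_pow (rot_prod TT) N)) (f : IJK -> R) :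
  \prod_(d : 'I_N * 'I_3) f (rot_annot TT N s d.1 d.2) =
  \prod_(b : IJK) f b ^+ (\sum_(k < 3) #|[set l | rot_annot TT N s l k == b]|)%N.
Proof.
rewrite -(pair_bigA _ (fun l (k : 'I_3) => f (rot_annot TT N s l k))) /= exchange_big /=.
under [RHS]eq_bigr => b _ do rewrite -prodrXr.
rewrite [RHS]exchange_big /=; apply: eq_bigr => k _.
rewrite (partition_big (fun l => rot_annot TT N s l k : IJK) xpredT) //=.
apply: eq_bigr => b _; rewrite -prodr_const; apply: eq_big => l; first by rewrite inE.
by move=> /eqP ->.
Qed.

Section Restriction.
Variables (N : nat) (dl : R) (c e : IJK -> R).
Local Notation En := (etensor_pow (rot_prod TT) N).
Hypotheses (N0 : (0 < N)%N) (dl0 : 0 < dl) (c0 : forall b, 0 < c b) (e0 : forall b, 0 <= e b).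
Hypothesis hc : forall b n, ((0 < n)%N -> b \in supp TT) ->
  block_achieves (rho := rho) (F := F) (q := q) fx fy fz b n (c b * (e b * dl) ^+ (3 * n)).

(** The type of a constituent. Occurrences are counted separately for each rotation, as
    [outer_achieves] requires, and bounded by [N], so that the number of types is polynomial in
    [N]. *)
Definition block_count (s : annot En) : {ffun IJK * 'I_3 -> 'I_N.+1} :=
  [ffun bk : IJK * 'I_3 => inord #|[set l | rot_annot TT N s l bk.2 == bk.1]|].

Lemma block_countE s b (k : 'I_3) :
  #|[set l | rot_annot TT N s l k == b]| = block_count s (b, k).
Proof.
rewrite ffunE inordK // ltnS; apply: leq_trans (max_card _) _.
by rewrite card_ord.
Qed.

Definition type_value (tau : {ffun IJK * 'I_3 -> 'I_N.+1}) : R :=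
  \prod_(b : IJK) (e b * dl) ^+ (\sum_(k < 3) tau (b, k))%N.

Lemma type_value_ge0 tau : 0 <= type_value tau.
Proof.
by apply: prodr_ge0 => b _; rewrite exprn_ge0 // mulr_ge0 ?(ltW dl0).
Qed.

Lemma prod_type_value (s : annot En) :
  (\prod_(d : 'I_N * 'I_3) e (rot_annot TT N s d.1 d.2)) * dl ^+ (3 * N) =
  type_value (block_count s).
Proof.
have -> : dl ^+ (3 * N) = \prod_(d : 'I_N * 'I_3) dl.
  by rewrite prodr_const card_prod !card_ord mulnC.
rewrite -big_split /= (prod_rot_annot N s (fun b => e b * dl)).
apply: eq_bigr => b _; congr (_ ^+ _); apply: eq_bigr => k _.
exact: block_countE.
Qed.

(** The cube comes from the three rotated copies: [outer_achieves] offers [#|Sg| ^ 3] regions, in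
    each of which every block gets three times its count in a single constituent. *)
Lemma type_bound (A : kept En) (tau : {ffun IJK * 'I_3 -> 'I_N.+1}) :
  strongly_disjoint (supp (prestrict A)) ->
  (\prod_b c b) *
    (#|[set s in supp (prestrict A) | block_count s == tau]|%:R * type_value tau) ^+ 3
  <= Vm ^+ (18 * N).
Proof.
move=> sd; set Sg := [set s in _ | _].
have V0 : 0 <= Vm by apply: le_trans (Vm_ge1 rho0 rho3).
have [Sg0|[s0 s0S]] := set_0Vmem Sg.
  by rewrite Sg0 cards0 mul0r expr0n mulr0 exprn_ge0.
have sub : {subset Sg <= supp (prestrict A)} by move=> s; rewrite inE => /andP[].
have cntE s b (k : 'I_3) : s \in Sg -> #|[set l | rot_annot TT N s l k == b]| = tau (b, k).
  by rewrite inE => /andP[_ /eqP <-]; apply: block_countE.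
pose r b := c b * (e b * dl) ^+ (3 * (\sum_(k < 3) tau (b, k))%N).
have r0 b : 0 <= r b.
  by rewrite mulr_ge0 ?(ltW (c0 b)) // exprn_ge0 // mulr_ge0 ?(ltW dl0).
have hr b : block_achieves (rho := rho) (F := F) (q := q) fx fy fz b (\sum_(k < 3) tau (b, k))%N (r b).
  apply: hc => n0.
  (* A block with positive count occurs in [s0], so it lies in the support of the repartitioning, as
     [hc] demands. *)
  have [k hk] : exists k : 'I_3, (0 < tau (b, k))%N.
    apply/existsP; apply: contraLR n0; rewrite negb_exists => /forallP h.
    by rewrite -leqNgt big1 // => k _; apply/eqP; rewrite -leqn0 leqNgt.
  move: hk; rewrite -(cntE _ _ _ s0S) => /card_gt0P [l]; rewrite inE => /eqP <-.
  have [h _] := elimT (@supp_prestrictP F En A s0) (sub _ s0S).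
  by move/(supp_rot_annotP TT N s0): h.
have := outer_achieves fx fy fz N A Sg (fun b k => tau (b, k) : nat) r sd sub cntE r0 hr.
move=> /Vm_pow_ge h; apply: le_trans (Vm_ge rho0 rho3 _ _); last by rewrite muln_gt0.
apply: le_trans h; rewrite /r big_split /= /type_value.
have -> : \prod_b (e b * dl) ^+ (3 * (\sum_(k < 3) tau (b, k))%N) =
   (\prod_b (e b * dl) ^+ (\sum_(k < 3) tau (b, k))%N) ^+ 3.
  by rewrite -prodrXl; apply: eq_bigr => b _; rewrite mulnC exprM.
by rewrite natrX exprMn mulrCA.
Qed.

Lemma restriction_bound (A : kept En) :
  strongly_disjoint (supp (prestrict A)) ->
  (\prod_b c b) * ((\sum_(s in supp (prestrict A)) \prod_(d : 'I_N * 'I_3) e (rot_annot TT N s d.1 d.2)) * dl ^+ (3 * N)) ^+ 3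
  <= ((N.+1 ^ #|{: IJK * 'I_3}|)%:R) ^+ 3 * Vm ^+ (18 * N).
Proof.
move=> sd.
pose a tau := #|[set s in supp (prestrict A) | block_count s == tau]|%:R * type_value tau.
have a0 tau : 0 <= a tau by rewrite mulr_ge0 // type_value_ge0.
pose y := \big[Num.max/0]_tau a tau.
have y0 : 0 <= y by apply: bigmax_ge_id.
have cp : 0 < \prod_b c b by apply: prodr_gt0 => b _.
have yV : (\prod_b c b) * y ^+ 3 <= Vm ^+ (18 * N).
  rewrite /y; apply: (big_ind (fun y => (\prod_b c b) * y ^+ 3 <= Vm ^+ (18 * N))).
  - by rewrite expr0n mulr0 exprn_ge0 // (le_trans _ (Vm_ge1 rho0 rho3)).
  - by move=> u v hu hv; rewrite /Num.max; case: ifP.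
  - by move=> tau _; apply: type_bound.
have -> : (\sum_(s in supp (prestrict A)) \prod_(d : 'I_N * 'I_3) e (rot_annot TT N s d.1 d.2)) * dl ^+ (3 * N) = \sum_tau a tau.
  rewrite big_distrl /= (partition_big block_count xpredT) //=.
  apply: eq_bigr => tau _; rewrite /a mulr_natl -sumr_const.
  apply: eq_big => s; first by rewrite inE.
  by move=> /andP[_ /eqP <-]; rewrite prod_type_value.
(* The total is at most the number of types times the contribution of the most valuable type. *)
have le : \sum_tau a tau <= (N.+1 ^ #|{: IJK * 'I_3}|)%:R * y.
  apply: (@le_trans _ _ (\sum_(tau : {ffun IJK * 'I_3 -> 'I_N.+1}) y)).
    by apply: ler_sum => tau _; apply: (bigmax_sup tau).
  by rewrite sumr_const card_ffun card_ord mulr_natl.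
apply: (@le_trans _ _ ((\prod_b c b) * ((N.+1 ^ #|{: IJK * 'I_3}|)%:R * y) ^+ 3)).
  rewrite ler_pM2l //; apply: lerXn2r; rewrite ?nnegrE //.
    by apply: sumr_ge0 => tau _.
  by rewrite mulr_ge0.
by rewrite exprMn mulrCA ler_wpM2l // exprn_ge0.
Qed.

End Restriction.

Lemma outer_bound (dl : R) : 0 < dl < 1 ->
  exists C : R, 0 < C /\ forall N, (0 < N)%N ->
    C * (Vpr_pow TT rho N * dl ^+ (3 * N)) ^+ 3
    <= ((N.+1 ^ #|{: IJK * 'I_3}|)%:R) ^+ 3 * Vm ^+ (18 * N).
Proof.
move=> hdl; have [dl0 _] := andP hdl.
have h (b : IJK) : exists c : R, 0 < c /\ forall n, ((0 < n)%N -> b \in supp TT) ->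
    block_achieves (rho := rho) (F := F) (q := q) fx fy fz b n (c * (estTT b * dl) ^+ (3 * n)).
  exact: block_lower_bound.
have [c hc] := choice h.
have c0 b : 0 < c b := (hc b).1.
exists (\prod_b c b); split; first by apply: prodr_gt0 => b _.
move=> N N0; pose P x := (\prod_b c b) * (x * dl ^+ (3 * N)) ^+ 3 <=
  ((N.+1 ^ #|{: IJK * 'I_3}|)%:R) ^+ 3 * Vm ^+ (18 * N).
apply: (@max_disjoint_value_ind R F (etensor_pow (rot_prod TT) N) rho P); rewrite /P.
- rewrite mul0r expr0n mulr0 mulr_ge0 ?exprn_ge0 //.
  exact: le_trans (Vm_ge1 rho0 rho3).
- move=> A sd; rewrite (eq_bigr _ (fun s _ => est_rot_annot TT N rho s)).
  exact: (restriction_bound N dl c estTT N0 dl0 c0 (est_ge0 fx fy fz) (fun b => (hc b).2) A sd).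
Qed.

Lemma Vpr_le_Vm_sqr : Vpr TT rho <= Vm ^+ 2.
Proof.
apply: (root_comparison (Vpr_pow TT rho) _ _ #|{: IJK * 'I_3}|).
- exact: Vm_ge1.
- by move=> n; apply: Vpr_pow_ge0.
- exact: Vpr_pow_lower.
- exact: outer_bound.
Qed.

End OuterBound.

Theorem mainTheorem6 (R : realType) (F : fieldType) (q : nat) (hq : (1 <= q)%N)
    (I J K : finType)
    (fx : 'I_3 * 'I_3 -> I) (fy : 'I_3 * 'I_3 -> J) (fz : 'I_3 * 'I_3 -> K)
    (rho : R) (hrho : 2 <= rho <= 3) :
  Vpr (@repartition R F (cw R F q) (cw R F q) I J K fx fy fz) rho `^ (2^-1)
    <= Vm (cw R F q) rho.
Proof.
have [rho2 rho3] := andP hrho.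
have rho0 : 0 <= rho by apply: le_trans rho2.
have V0 : 0 <= Vm (cw R F q) rho by apply: le_trans (Vm_ge1 rho0 rho3).
rewrite powR12_sqrt ?Vpr_ge0 // -[leRHS]ger0_norm // -sqrtr_sqr ler_wsqrtr //.
exact: Vpr_le_Vm_sqr.
Qed.
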